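(* Assume $0\le\alpha<\beta$ and $\alpha+\beta<2$. Then, under $\mu_{N,\alpha,\beta,S}$, the vector $\sqrt N\,(m_1,m_2)$ converges in distribution as $N\to\infty$ to a centered two-dimensional Gaussian random vector with covariance matrix \[ \Sigma=s^2\begin{pmatrix}1&r\\ r&1\end{pmatrix},\qquad s^2=\frac{8-4\beta}{(2-\beta)^2-\alpha^2},\qquad r=\frac{\alpha}{2-\beta}. \]
   Context: Block spin Ising model: $N$ is even, $S\subset\{1,\dots,N\}$ with $|S|=N/2$. Write $i\sim j$ if $i,j$ both lie in $S$ or both in $S^c$, $i\not\sim j$ otherwise. Hamiltonian $H_{N,\alpha,\beta,S}(\sigma)=-\frac{\beta}{2N}\sum_{i\sim j}\sigma_i\sigma_j-\frac{\alpha}{2N}\sum_{i\not\sim j}\sigma_i\sigma_j$ on $\{-1,+1\}^N$ (ordered pairs, including $i=j$), Gibbs measure $\mu_{N,\alpha,\beta,S}(\sigma)\propto e^{-H_{N,\alpha,\beta,S}(\sigma)}$. Block magnetizations $m_1=\frac2N\sum_{i\in S}\sigma_i$, $m_2=\frac2N\sum_{i\notin S}\sigma_i$. *)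

(* Defs.v *)
From Stdlib Require Import Reals Lra List.
Import ListNotations.
Open Scope R_scope.

(** Spin configurations in {-1,+1}^N, encoded as boolean lists of length N
    (true = +1, false = -1); sites are 0,...,N-1. *)
Fixpoint configs (n : nat) : list (list bool) :=
  match n with
  | O => [nil]
  | S k => map (cons true) (configs k) ++ map (cons false) (configs k)
  end.

Definition spin (sigma : list bool) (i : nat) : R :=
  if nth i sigma false then 1 else -1.

Definition sumR {A : Type} (f : A -> R) (l : list A) : R :=
  fold_right (fun a acc => f a + acc) 0 l.

Definition sites (N : nat) : list nat := seq 0 N.

(** The block S is given by its indicator [Sb : nat -> bool]. *)
Definition same_block (Sb : nat -> bool) (i j : nat) : bool := Bool.eqb (Sb i) (Sb j).

(** H_{N,alpha,beta,S}(sigma), sums over ordered pairs (i,j) including i = j. *)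
Definition hamiltonian (N : nat) (alpha beta : R) (Sb : nat -> bool)
  (sigma : list bool) : R :=
  - (beta / (2 * INR N)) *
      sumR (fun i => sumR (fun j =>
        if same_block Sb i j then spin sigma i * spin sigma j else 0) (sites N)) (sites N)
  - (alpha / (2 * INR N)) *
      sumR (fun i => sumR (fun j =>
        if same_block Sb i j then 0 else spin sigma i * spin sigma j) (sites N)) (sites N).

Definition gibbs_expect (N : nat) (alpha beta : R) (Sb : nat -> bool)
  (g : list bool -> R) : R :=
  sumR (fun s => exp (- hamiltonian N alpha beta Sb s) * g s) (configs N)
  / sumR (fun s => exp (- hamiltonian N alpha beta Sb s)) (configs N).

Definition mag1 (N : nat) (Sb : nat -> bool) (sigma : list bool) : R :=
  (2 / INR N) * sumR (fun i => if Sb i then spin sigma i else 0) (sites N).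
Definition mag2 (N : nat) (Sb : nat -> bool) (sigma : list bool) : R :=
  (2 / INR N) * sumR (fun i => if Sb i then 0 else spin sigma i) (sites N).

Definition bounded2 (f : R -> R -> R) : Prop :=
  exists M, forall x y, Rabs (f x y) <= M.
Definition continuous2 (f : R -> R -> R) : Prop :=
  forall x y eps, 0 < eps -> exists delta, 0 < delta /\
    forall x' y', Rabs (x' - x) < delta -> Rabs (y' - y) < delta ->
      Rabs (f x' y' - f x y) < eps.

Definition riemann_value (f : R -> R) (a b v : R) : Prop :=
  exists pr : Riemann_integrable f a b, RiemannInt pr = v.

(** Improper integral over R^2: limit, as Rr -> oo, of the (iterated)
    Riemann integral over the square [-Rr,Rr]^2. *)
Definition integral_R2 (g : R -> R -> R) (v : R) : Prop :=
  forall eps, 0 < eps -> exists R0, forall Rr, R0 <= Rr ->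
    exists (h : R -> R) (w : R),
      (forall x, riemann_value (fun y => g x y) (- Rr) Rr (h x)) /\
      riemann_value h (- Rr) Rr w /\ Rabs (w - v) < eps.

(** Density of the centered Gaussian on R^2 with covariance
    [[s11, s12], [s12, s22]] (assumed positive definite). *)
Definition gauss2_density (s11 s12 s22 : R) (x y : R) : R :=
  let D := s11 * s22 - s12 ^ 2 in
  exp (- (s22 * x ^ 2 - 2 * s12 * x * y + s11 * y ^ 2) / (2 * D))
  / (2 * PI * sqrt D).

(** Convergence in distribution of a sequence of R^2-valued laws, given by
    their expectation functionals E n, to the centered Gaussian with the
    given covariance: E n f -> E[f(Z)] for every bounded continuous f. *)
Definition conv_in_distr_gauss2 (E : nat -> (R -> R -> R) -> R)
  (s11 s12 s22 : R) : Prop :=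
  forall f, bounded2 f -> continuous2 f ->
    exists v, integral_R2 (fun x y => f x y * gauss2_density s11 s12 s22 x y) v
              /\ Un_cv (fun n => E n f) v.

(* Main.v *)
From Coquelicot Require Import Coquelicot.
Require Import Defs.
From Stdlib Require Import Reals Lra Lia List.
Open Scope R_scope.

(** Everything depends on the pair of block sums, which takes the value (2k-n, 2l-n) with Gibbs
    weight C(n,k) C(n,l) exp(energy); the sums to be compared are thus two-dimensional Riemann
    sums over the lattice of values of the scaled magnetizations, and the normalization of the
    binomial coefficients cancels between numerator and partition function.  With d = 2k-n, the
    ratio C(n,k+1)/C(n,k) equals (1-x)/(1+x) for x = (d+1)/(n+1), and (1-x)/(1+x) <= exp(-2x) for
    x >= 0, so C(n,k) exp(d^2/(2(n+1))) is unimodal with its maximum in the middle.  This gives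
    both a global Gaussian upper bound, integrable against the interaction because
    alpha + beta < 2, and, as (1-x)/(1+x) >= exp(-2x-2x^2), the local Gaussian limit.  Hence on
    every lattice cell the weights differ from the limiting unnormalized density by at most
    eps / ((1+x^2)(1+y^2)), and summation over all cells yields convergence of numerator and
    denominator. *)

(** * Reduction to binomial sums *)

(** Dividing by the central term replaces Stirling's formula: no asymptotics of the central binomial
    coefficient is needed. The scaled block sums are spaced by 2 sqrt(2/n), and the cells of that
    width centred at them tile a square exactly, with half side (n+1) sqrt(2/n) tending to infinity.
    Since the tiled area grows, an error bound uniform over the cells would not suffice; the weight
    1/((1+x^2)(1+y^2)) is chosen because its integral over any square is at most pi^2. In the scaled
    variables the entropy gives -(x^2+y^2)/4 and the interaction beta (x^2+y^2)/8 + alpha x y/4, so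
    the limiting exponent is -a(x^2+y^2) + 2b x y with a = (2-beta)/8 and b = alpha/8; here b < a is
    exactly alpha + beta < 2. The limit of the partition function must be known in closed form, as
    pi/sqrt(a^2-b^2); this comes from a one-dimensional identity with explicit remainder, without
    polar coordinates. *)

Lemma sumR_ext {A : Type} (f g : A -> R) (l : list A) :
  (forall a, In a l -> f a = g a) -> sumR f l = sumR g l.
Proof.
  induction l as [|a l IH]; intros H; simpl; [reflexivity|].
  rewrite (H a) by (left; reflexivity).
  rewrite IH; [reflexivity|]. intros b Hb; apply H; right; exact Hb.
Qed.

Lemma sumR_plus {A : Type} (f g : A -> R) (l : list A) :
  sumR (fun a => f a + g a) l = sumR f l + sumR g l.
Proof. induction l as [|a l IH]; simpl; [ring | rewrite IH; ring]. Qed.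

Lemma sumR_scal {A : Type} (c : R) (f : A -> R) (l : list A) :
  sumR (fun a => c * f a) l = c * sumR f l.
Proof. induction l as [|a l IH]; simpl; [ring | rewrite IH; ring]. Qed.

Lemma sumR_app {A : Type} (f : A -> R) (l1 l2 : list A) :
  sumR f (l1 ++ l2) = sumR f l1 + sumR f l2.
Proof. induction l1 as [|a l IH]; simpl; [ring | rewrite IH; ring]. Qed.

Lemma sumR_map {A B : Type} (g : A -> B) (f : B -> R) (l : list A) :
  sumR f (map g l) = sumR (fun a => f (g a)) l.
Proof. induction l as [|a l IH]; simpl; [reflexivity | rewrite IH; reflexivity]. Qed.

Lemma sumR_prod {A : Type} (f g : A -> R) (l : list A) :
  sumR (fun i => sumR (fun j => f i * g j) l) l = sumR f l * sumR g l.
Proof.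
  rewrite Rmult_comm, <- sumR_scal. apply sumR_ext; intros a _.
  rewrite sumR_scal; ring.
Qed.

Definition sumS (N : nat) (Sb : nat -> bool) (sg : list bool) : R :=
  sumR (fun i => if Sb i then spin sg i else 0) (sites N).

Definition sumSc (N : nat) (Sb : nat -> bool) (sg : list bool) : R :=
  sumR (fun i => if Sb i then 0 else spin sg i) (sites N).

(** Split the spins into their parts on the block and on its complement: each double sum becomes a
    sum of terms that factor by [sumR_prod]. *)
Lemma hamiltonian_sums (N : nat) (alpha beta : R) (Sb : nat -> bool) (sg : list bool) :
  - hamiltonian N alpha beta Sb sg =
  beta / (2 * INR N) * (sumS N Sb sg ^ 2 + sumSc N Sb sg ^ 2)
  + alpha / (2 * INR N) * (2 * (sumS N Sb sg * sumSc N Sb sg)).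
Proof.
  unfold hamiltonian.
  set (a := fun i => if Sb i then spin sg i else 0).
  set (b := fun i => if Sb i then 0 else spin sg i).
  rewrite (sumR_ext _ (fun i => sumR (fun j => a i * a j) (sites N)
                                + sumR (fun j => b i * b j) (sites N))).
  2:{ intros i _. rewrite <- sumR_plus. apply sumR_ext; intros j _.
      unfold same_block, a, b. destruct (Sb i), (Sb j); simpl; ring. }
  rewrite (sumR_ext (fun i => sumR (fun j => if same_block Sb i j then 0 else _) _)
             (fun i => sumR (fun j => a i * b j) (sites N)
                       + sumR (fun j => b i * a j) (sites N))).
  2:{ intros i _. rewrite <- sumR_plus. apply sumR_ext; intros j _.
      unfold same_block, a, b. destruct (Sb i), (Sb j); simpl; ring. }
  rewrite !sumR_plus, !sumR_prod.
  fold a b. change (sumS N Sb sg) with (sumR a (sites N)).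
  change (sumSc N Sb sg) with (sumR b (sites N)). ring.
Qed.

(** The sum of [phi] of the block sum over all configurations of a block of [n] sites, grouped by
    the number [k] of plus spins. *)
Definition bsum (n : nat) (phi : R -> R) : R :=
  sum_f_R0 (fun k => C n k * phi (2 * INR k - INR n)) n.

Lemma C_0 (n : nat) : C n 0 = 1.
Proof.
  unfold C. rewrite Nat.sub_0_r. simpl. field. apply INR_fact_neq_0.
Qed.

Lemma C_n (n : nat) : C n n = 1.
Proof.
  unfold C. rewrite Nat.sub_diag. simpl. field. apply INR_fact_neq_0.
Qed.

(** Pascal's rule, read as fixing the spin of one added site. *)
Lemma bsum_S (n : nat) (phi : R -> R) :
  bsum (S n) phi = bsum n (fun u => phi (1 + u)) + bsum n (fun u => phi (-1 + u)).
Proof.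
  unfold bsum. destruct n as [|n].
  { simpl. rewrite !C_0, C_n.
    replace (2 * 0 - 1) with (-1 + (2 * 0 - 0)) by ring.
    replace (2 * 1 - 1) with (1 + (2 * 0 - 0)) by ring. ring. }
  (* [C] does not vanish for [k] beyond [n], so Pascal's rule covers interior terms only; the first
     and the last term are split off. *)
  rewrite (decomp_sum _ (S (S n))) by lia. simpl pred. rewrite tech5.
  rewrite (sum_eq _ (fun i => C (S n) i * phi (1 + (2 * INR i - INR (S n)))
                              + C (S n) (S i) * phi (-1 + (2 * INR (S i) - INR (S n))))).
  2:{ intros i Hi. rewrite <- pascal by lia. rewrite !S_INR.
      replace (2 * (INR i + 1) - (INR n + 1 + 1)) with (1 + (2 * INR i - (INR n + 1))) by ring.
      replace (-1 + (2 * (INR i + 1) - (INR n + 1))) with (1 + (2 * INR i - (INR n + 1))) by ring.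
      ring. }
  rewrite sum_plus.
  rewrite (tech5 (fun k => C (S n) k * phi (1 + (2 * INR k - INR (S n))))).
  rewrite (decomp_sum (fun k => C (S n) k * phi (-1 + (2 * INR k - INR (S n))))) by lia.
  simpl pred. rewrite !C_0, !C_n.
  replace (2 * INR 0 - INR (S (S n))) with (-1 + (2 * INR 0 - INR (S n)))
    by (rewrite !S_INR; simpl; ring).
  replace (2 * INR (S (S n)) - INR (S (S n))) with (1 + (2 * INR (S n) - INR (S n)))
    by (rewrite !S_INR; simpl; ring).
  ring.
Qed.

Lemma bsum_ext (n : nat) (phi psi : R -> R) :
  (forall u, phi u = psi u) -> bsum n phi = bsum n psi.
Proof. intros H. apply sum_eq. intros i _. rewrite H; reflexivity. Qed.

Lemma bsum_plus (n : nat) (phi psi : R -> R) :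
  bsum n (fun u => phi u + psi u) = bsum n phi + bsum n psi.
Proof.
  unfold bsum. rewrite <- sum_plus. apply sum_eq; intros; ring.
Qed.

Lemma sumR_seq_shift (f : nat -> R) (n : nat) :
  sumR f (seq 1 n) = sumR (fun i => f (S i)) (seq 0 n).
Proof. rewrite <- seq_shift. apply sumR_map. Qed.

Lemma filter_seq_shift (P : nat -> bool) (n : nat) :
  length (filter P (seq 1 n)) = length (filter (fun i => P (S i)) (seq 0 n)).
Proof.
  rewrite <- seq_shift. generalize (seq 0 n) as l.
  induction l as [|a l IH]; simpl; [reflexivity|].
  destruct (P (S a)); simpl; rewrite IH; reflexivity.
Qed.

Lemma sumS_cons (N : nat) (Sb : nat -> bool) (b : bool) (sg : list bool) :
  sumS (S N) Sb (b :: sg) =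
  (if Sb 0%nat then if b then 1 else -1 else 0) + sumS N (fun i => Sb (S i)) sg.
Proof.
  unfold sumS, sites. simpl. rewrite sumR_seq_shift. reflexivity.
Qed.

Lemma sumSc_cons (N : nat) (Sb : nat -> bool) (b : bool) (sg : list bool) :
  sumSc (S N) Sb (b :: sg) =
  (if Sb 0%nat then 0 else if b then 1 else -1) + sumSc N (fun i => Sb (S i)) sg.
Proof.
  unfold sumSc, sites. simpl. rewrite sumR_seq_shift. reflexivity.
Qed.

(** Induction that removes site 0: its spin becomes a shift of one argument of [Phi], and [bsum_S]
    applies to the outer or the inner sum according to its block. Hence [Sb] and [Phi] must be
    general and the two block sizes arbitrary. *)
Lemma configs_sum (N : nat) (Sb : nat -> bool) (Phi : R -> R -> R) :
  sumR (fun sg => Phi (sumS N Sb sg) (sumSc N Sb sg)) (configs N) =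
  bsum (length (filter Sb (seq 0 N)))
    (fun u => bsum (length (filter (fun i => negb (Sb i)) (seq 0 N))) (fun v => Phi u v)).
Proof.
  revert Sb Phi. induction N as [|N IH]; intros Sb Phi.
  { unfold bsum, sumS, sumSc. simpl. rewrite !C_0.
    replace (2 * 0 - 0) with 0 by ring. ring. }
  change (configs (S N)) with (map (cons true) (configs N) ++ map (cons false) (configs N)).
  rewrite sumR_app, !sumR_map.
  change (seq 0 (S N)) with (0 :: seq 1 N)%nat.
  rewrite (sumR_ext _ (fun sg =>
    Phi ((if Sb 0%nat then 1 else 0) + sumS N (fun i => Sb (S i)) sg)
        ((if Sb 0%nat then 0 else 1) + sumSc N (fun i => Sb (S i)) sg)))
    by (intros; rewrite sumS_cons, sumSc_cons; reflexivity).
  rewrite (sumR_ext (fun a => Phi (sumS (S N) Sb (false :: a)) _) (fun sg =>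
    Phi ((if Sb 0%nat then -1 else 0) + sumS N (fun i => Sb (S i)) sg)
        ((if Sb 0%nat then 0 else -1) + sumSc N (fun i => Sb (S i)) sg)))
    by (intros; rewrite sumS_cons, sumSc_cons; reflexivity).
  rewrite (IH (fun i => Sb (S i)) (fun x y =>
    Phi ((if Sb 0%nat then 1 else 0) + x) ((if Sb 0%nat then 0 else 1) + y))).
  rewrite (IH (fun i => Sb (S i)) (fun x y =>
    Phi ((if Sb 0%nat then -1 else 0) + x) ((if Sb 0%nat then 0 else -1) + y))).
  simpl filter. destruct (Sb 0%nat); simpl length; rewrite !filter_seq_shift.
  - rewrite bsum_S. f_equal; apply bsum_ext; intros u; apply bsum_ext; intros v;
      f_equal; ring.
  - rewrite <- bsum_plus. apply bsum_ext; intros u. rewrite bsum_S.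
    f_equal; apply bsum_ext; intros v; f_equal; ring.
Qed.

Definition energy (alpha beta N u v : R) : R :=
  beta / (2 * N) * (u ^ 2 + v ^ 2) + alpha / (2 * N) * (2 * (u * v)).

Lemma gibbs_expect_bsum (n : nat) (alpha beta : R) (Sb : nat -> bool)
    (f : R -> R -> R) :
  length (filter Sb (seq 0 (2 * n))) = n ->
  gibbs_expect (2 * n) alpha beta Sb
    (fun sg => f (sqrt (INR (2 * n)) * mag1 (2 * n) Sb sg)
                 (sqrt (INR (2 * n)) * mag2 (2 * n) Sb sg)) =
  bsum n (fun u => bsum n (fun v => exp (energy alpha beta (INR (2 * n)) u v) *
      f (sqrt (INR (2 * n)) * (2 / INR (2 * n) * u))
        (sqrt (INR (2 * n)) * (2 / INR (2 * n) * v))))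
  / bsum n (fun u => bsum n (fun v => exp (energy alpha beta (INR (2 * n)) u v))).
Proof.
  intros Hc.
  assert (Hc' : length (filter (fun i => negb (Sb i)) (seq 0 (2 * n))) = n).
  { pose proof (filter_length Sb (seq 0 (2 * n))) as H.
    rewrite length_seq in H. lia. }
  assert (Hsum : forall g : R -> R -> R,
    sumR (fun sg => exp (- hamiltonian (2 * n) alpha beta Sb sg) *
                    g (sumS (2 * n) Sb sg) (sumSc (2 * n) Sb sg)) (configs (2 * n)) =
    bsum n (fun u => bsum n (fun v => exp (energy alpha beta (INR (2 * n)) u v) * g u v))).
  { intros g.
    pose proof (configs_sum (2 * n) Sb
      (fun u v => exp (energy alpha beta (INR (2 * n)) u v) * g u v)) as H.
    rewrite Hc, Hc' in H. rewrite <- H.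
    apply sumR_ext; intros sg _. rewrite hamiltonian_sums. reflexivity. }
  unfold gibbs_expect. f_equal; [| f_equal].
  - exact (Hsum (fun u v => f (sqrt (INR (2 * n)) * (2 / INR (2 * n) * u))
                              (sqrt (INR (2 * n)) * (2 / INR (2 * n) * v)))).
  - rewrite (sumR_ext _ (fun sg => exp (- hamiltonian (2 * n) alpha beta Sb sg) * 1))
      by (intros; ring).
    rewrite (Hsum (fun _ _ => 1)).
    apply bsum_ext; intros u; apply bsum_ext; intros v; ring.
Qed.

(** * Binomial coefficients near and far from the middle *)

Lemma exp_nondecr (x y : R) : x <= y -> exp x <= exp y.
Proof. intros [H| ->]; [left; apply exp_increasing, H | apply Rle_refl]. Qed.

(** The difference (1+x) exp(-x) - (1-x) exp(x) vanishes at 0 and has derivative x (exp(x) -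
    exp(-x)), which is nonnegative. *)
Lemma ratio_exp_le_1 (x : R) : 0 <= x -> (1 - x) / (1 + x) * exp (2 * x) <= 1.
Proof.
  intros Hx.
  set (g := fun x => (1 + x) * exp (- x) - (1 - x) * exp x).
  assert (Hg : g 0 <= g x).
  { destruct (MVT_gen g 0 x (fun x => x * (exp x - exp (- x)))) as [c [Hc Heq]].
    - intros y _. unfold g. auto_derive; [trivial | ring].
    - intros y _. apply derivable_continuous_pt.
      unfold g. apply ex_derive_Reals_0. auto_derive. trivial.
    - rewrite Rmin_left, Rmax_right in Hc by lra.
      assert (0 <= c * (exp c - exp (- c))).
      { apply Rmult_le_pos; [lra|].
        destruct (Rle_lt_or_eq_dec 0 c) as [H|H]; [lra | | subst c; rewrite Ropp_0; lra].
        pose proof (exp_increasing (- c) c). lra. }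
      nra. }
  unfold g in Hg. rewrite Ropp_0, exp_0 in Hg.
  replace (2 * x) with (x + x) by ring. rewrite exp_plus.
  rewrite exp_Ropp in Hg. pose proof (exp_pos x).
  apply Rmult_le_reg_l with ((1 + x) * / exp x).
  { apply Rmult_lt_0_compat; [lra | apply Rinv_0_lt_compat; assumption]. }
  replace ((1 + x) * / exp x * ((1 - x) / (1 + x) * (exp x * exp x)))
    with ((1 - x) * exp x) by (field; split; lra).
  lra.
Qed.

(** Both factors are bounded by 1 + t <= exp(t), with t = x and t = x + 2x^2. The bound 1/2 enters
    through (1 + x + 2x^2)(1 - x) = 1 + x^2 - 2x^3 >= 1. *)
Lemma ratio_exp_ge (x : R) : 0 <= x <= 1 / 2 ->
  exp (- (2 * x ^ 2)) <= (1 - x) / (1 + x) * exp (2 * x).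
Proof.
  intros Hx.
  assert (H1 : exp (- x) * (1 + x) <= 1).
  { rewrite exp_Ropp. pose proof (exp_ineq1_le x). pose proof (exp_pos x).
    apply Rmult_le_reg_l with (exp x); [assumption|].
    rewrite <- Rmult_assoc, Rinv_r by lra. lra. }
  assert (H2 : exp (- (x + 2 * x ^ 2)) <= 1 - x).
  { rewrite exp_Ropp. pose proof (exp_ineq1_le (x + 2 * x ^ 2)).
    pose proof (exp_pos (x + 2 * x ^ 2)).
    apply Rmult_le_reg_l with (exp (x + 2 * x ^ 2)); [assumption|].
    rewrite Rinv_r by lra.
    apply Rle_trans with ((1 + (x + 2 * x ^ 2)) * (1 - x)); nra. }
  replace (- (2 * x ^ 2)) with (- x + (- (x + 2 * x ^ 2) + (x + x))) by ring.
  replace (2 * x) with (x + x) by ring.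
  rewrite (exp_plus (- x)), (exp_plus (- (x + 2 * x ^ 2))).
  unfold Rdiv.
  pose proof (exp_pos (x + x)).
  assert (exp (- x) <= / (1 + x)).
  { apply Rmult_le_reg_r with (1 + x); [lra|]. rewrite Rinv_l by lra. assumption. }
  pose proof (exp_pos (- x)). pose proof (exp_pos (- (x + 2 * x ^ 2))).
  assert (exp (- x) * exp (- (x + 2 * x ^ 2)) <= / (1 + x) * (1 - x))
    by (apply Rmult_le_compat; lra).
  replace ((1 - x) * / (1 + x) * exp (x + x)) with ((/ (1 + x) * (1 - x)) * exp (x + x)) by ring.
  rewrite <- Rmult_assoc. apply Rmult_le_compat_r; lra.
Qed.

Definition dev (n k : nat) : R := 2 * INR k - INR n.

(* The factor turns the Gaussian decay of the binomial coefficients into exact unimodality. *)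
Definition tilted (n k : nat) : R := C n k * exp (dev n k ^ 2 / (2 * (INR n + 1))).

Lemma C_pos (n k : nat) : 0 < C n k.
Proof.
  unfold C. apply Rdiv_lt_0_compat; [apply INR_fact_lt_0|].
  apply Rmult_lt_0_compat; apply INR_fact_lt_0.
Qed.

Lemma C_succ (n k : nat) : (k < n)%nat ->
  C n (S k) = C n k * ((INR n - INR k) / (INR k + 1)).
Proof.
  intros Hk. unfold C.
  replace (n - k)%nat with (S (n - S k)) by lia.
  rewrite !fact_simpl, !mult_INR, !S_INR, minus_INR, S_INR by lia.
  pose proof (pos_INR k). pose proof (lt_INR _ _ Hk).
  field. repeat split; try apply INR_fact_neq_0; lra.
Qed.

Lemma tilted_pos (n k : nat) : 0 < tilted n k.
Proof. apply Rmult_lt_0_compat; [apply C_pos | apply exp_pos]. Qed.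

(** The exponent grows by exactly 2x because (d+2)^2 - d^2 = 4(d+1); the denominator [n + 1] is the
    one for which (n-k)/(k+1) takes the form (1-x)/(1+x). *)
Lemma tilted_succ (n k : nat) : (k < n)%nat ->
  let x := (dev n k + 1) / (INR n + 1) in
  tilted n (S k) = tilted n k * ((1 - x) / (1 + x) * exp (2 * x)).
Proof.
  intros Hk x. unfold tilted. rewrite C_succ by assumption.
  pose proof (pos_INR k). pose proof (pos_INR n). pose proof (lt_INR _ _ Hk).
  replace (dev n (S k) ^ 2 / (2 * (INR n + 1)))
    with (dev n k ^ 2 / (2 * (INR n + 1)) + 2 * x).
  2:{ unfold x, dev. rewrite S_INR. field. lra. }
  rewrite exp_plus.
  replace ((1 - x) / (1 + x)) with ((INR n - INR k) / (INR k + 1)).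
  { ring. }
  unfold x, dev. field. repeat split; lra.
Qed.

Lemma tilted_sym (n k : nat) : (k <= n)%nat -> tilted n (n - k) = tilted n k.
Proof.
  intros Hk. unfold tilted. rewrite <- pascal_step1 by assumption. f_equal.
  unfold dev. rewrite minus_INR by assumption. f_equal. f_equal. ring.
Qed.

Lemma dev_sym (n k : nat) : (k <= n)%nat -> dev n (n - k) = - dev n k.
Proof. intros Hk. unfold dev. rewrite minus_INR by assumption. ring. Qed.

(** Ensures x >= 0 in [tilted_succ] from the index [n / 2] on, also for odd [n], where that index
    lies half a step below the centre. *)
Lemma dev_mid (n k : nat) : (n / 2 <= k)%nat -> -1 <= dev n k.
Proof.
  intros Hk. unfold dev.
  assert (H : (n <= 2 * k + 1)%nat) by (pose proof (Nat.div_mod_eq n 2);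
    pose proof (Nat.mod_upper_bound n 2); lia).
  apply le_INR in H. rewrite plus_INR, mult_INR in H. simpl in H. lra.
Qed.

Lemma tilted_le_mid_aux (n k : nat) : (n / 2 <= k <= n)%nat ->
  tilted n k <= tilted n (n / 2).
Proof.
  intros [H1 H2]. induction k as [|k IH].
  { replace (n / 2)%nat with 0%nat by lia. lra. }
  destruct (Nat.eq_dec (n / 2) (S k)) as [->|Hne]; [lra|].
  apply Rle_trans with (tilted n k); [|apply IH; lia].
  rewrite tilted_succ by lia.
  rewrite <- (Rmult_1_r (tilted n k)) at 2.
  apply Rmult_le_compat_l; [left; apply tilted_pos|].
  apply ratio_exp_le_1. pose proof (dev_mid n k). pose proof (pos_INR n).
  apply Rdiv_le_0_compat; [apply Rplus_le_reg_r with (-1); ring_simplify; apply H; lia | lra].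
Qed.

Lemma upper_half (n k : nat) : (k <= n)%nat ->
  (n / 2 <= k)%nat \/ (n / 2 <= n - k)%nat.
Proof. intros. pose proof (Nat.div_mod_eq n 2). lia. Qed.

Lemma tilted_le_mid (n k : nat) : (k <= n)%nat -> tilted n k <= tilted n (n / 2).
Proof.
  intros Hk. destruct (upper_half n k Hk) as [H|H].
  - apply tilted_le_mid_aux; lia.
  - rewrite <- tilted_sym by assumption. apply tilted_le_mid_aux; lia.
Qed.

(** Each of the [k - n / 2] steps from the middle costs at most a factor exp(-2X^2); x increases
    with [k], so bounding it at the endpoint by [X] bounds it at every step. *)
Lemma tilted_ge_mid_aux (n k : nat) (X : R) : (n / 2 <= k <= n)%nat ->
  X <= 1 / 2 -> (dev n k + 1) / (INR n + 1) <= X ->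
  tilted n (n / 2) * exp (- (INR (k - n / 2) * (2 * X ^ 2))) <= tilted n k.
Proof.
  intros [H1 H2] HX. induction k as [|k IH]; intros Hd.
  { replace (n / 2)%nat with 0%nat by lia. simpl INR.
    rewrite Rmult_0_l, Ropp_0, exp_0. lra. }
  destruct (Nat.eq_dec (n / 2) (S k)) as [->|Hne].
  { rewrite Nat.sub_diag. simpl INR. rewrite Rmult_0_l, Ropp_0, exp_0. lra. }
  pose proof (pos_INR n).
  set (x := (dev n k + 1) / (INR n + 1)).
  assert (Hx : 0 <= x).
  { apply Rdiv_le_0_compat; [|lra]. pose proof (dev_mid n k ltac:(lia)). lra. }
  assert (HxX : x <= X).
  { eapply Rle_trans; [|exact Hd]. apply Rmult_le_compat_r.
    - left; apply Rinv_0_lt_compat; lra.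
    - unfold dev. rewrite S_INR. lra. }
  rewrite tilted_succ by lia. fold x.
  replace (S k - n / 2)%nat with (S (k - n / 2)) by lia. rewrite S_INR.
  replace (- ((INR (k - n / 2) + 1) * (2 * X ^ 2)))
    with (- (INR (k - n / 2) * (2 * X ^ 2)) + - (2 * X ^ 2)) by ring.
  rewrite exp_plus, <- Rmult_assoc.
  apply Rmult_le_compat.
  - left; apply Rmult_lt_0_compat; [apply tilted_pos | apply exp_pos].
  - left; apply exp_pos.
  - apply IH; try lia. exact HxX.
  - apply Rle_trans with (exp (- (2 * x ^ 2))).
    + apply exp_nondecr. nra.
    + apply ratio_exp_ge. lra.
Qed.

Definition bratio (n k : nat) : R := tilted n k / tilted n (n / 2).

Lemma bratio_pos (n k : nat) : 0 < bratio n k.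
Proof. apply Rdiv_lt_0_compat; apply tilted_pos. Qed.

Lemma bratio_le_1 (n k : nat) : (k <= n)%nat -> bratio n k <= 1.
Proof.
  intros Hk. pose proof (tilted_pos n (n / 2)). unfold bratio.
  apply Rmult_le_reg_r with (tilted n (n / 2)); [assumption|].
  replace (tilted n k / tilted n (n / 2) * tilted n (n / 2)) with (tilted n k) by (field; lra).
  pose proof (tilted_le_mid n k Hk). lra.
Qed.

(** Twice the number of steps from the middle is at most |d| + 1, and exp(-t) >= 1 - t. The loss is
    (|d|+1)^3/(n+1)^2, of order n^(-1/2) when |d| is of order sqrt(n). *)
Lemma bratio_ge (n k : nat) : (k <= n)%nat ->
  let X := (Rabs (dev n k) + 1) / (INR n + 1) in
  X <= 1 / 2 -> 1 - (Rabs (dev n k) + 1) * X ^ 2 <= bratio n k.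
Proof.
  intros Hk X HX.
  pose proof (pos_INR n) as Hn.
  assert (Haux : forall j, (n / 2 <= j <= n)%nat -> Rabs (dev n j) = Rabs (dev n k) ->
    1 - (Rabs (dev n k) + 1) * X ^ 2 <= bratio n j).
  { intros j Hj Hdj. pose proof (tilted_pos n (n / 2)).
    apply Rle_trans with (exp (- (INR (j - n / 2) * (2 * X ^ 2)))).
    - eapply Rle_trans; [|apply exp_ineq1_le].
      assert (2 * INR (j - n / 2) <= Rabs (dev n k) + 1).
      { rewrite <- Hdj. rewrite minus_INR by lia. pose proof (Rle_abs (dev n j)).
        assert (INR n <= 2 * INR (n / 2) + 1).
        { pose proof (Nat.div_mod_eq n 2). pose proof (Nat.mod_upper_bound n 2).
          assert (Hle : (n <= 2 * (n / 2) + 1)%nat) by lia.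
          apply le_INR in Hle. rewrite plus_INR, mult_INR in Hle. change (INR 2) with 2 in Hle; change (INR 1) with 1 in Hle. lra. }
        unfold dev in *. lra. }
      pose proof (Rmult_le_compat_r (X ^ 2) _ _ (pow2_ge_0 X) H0). lra.
    - apply Rmult_le_reg_l with (tilted n (n / 2)); [assumption|].
      unfold bratio.
      replace (tilted n (n / 2) * (tilted n j / tilted n (n / 2))) with (tilted n j) by (field; lra).
      apply tilted_ge_mid_aux; [assumption | exact HX |].
      apply Rmult_le_compat_r; [left; apply Rinv_0_lt_compat; lra|].
      rewrite <- Hdj. pose proof (Rle_abs (dev n j)). lra. }
  destruct (upper_half n k Hk) as [H|H].
  - apply Haux; [lia | reflexivity].
  - assert (bratio n (n - k) = bratio n k) as <-
      by (unfold bratio; rewrite tilted_sym by assumption; reflexivity).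
    apply Haux; [lia|]. rewrite dev_sym by assumption. apply Rabs_Ropp.
Qed.

(** * Integrals over squares and Riemann sums *)

Lemma continuous2_2d_pt (g : R -> R -> R) :
  continuous2 g -> forall x y, continuity_2d_pt g x y.
Proof.
  intros Hg x y eps. destruct (Hg x y eps (cond_pos eps)) as [d [Hd H]].
  exists (mkposreal d Hd). exact H.
Qed.

Lemma continuous2_snd (g : R -> R -> R) (x y : R) :
  continuous2 g -> continuous (fun y => g x y) y.
Proof.
  intros Hg. apply continuity_pt_filterlim. intros eps Heps.
  destruct (Hg x y eps Heps) as [d [Hd H]]. exists d; split; [exact Hd|].
  intros z [_ Hz]. apply H; [rewrite Rminus_diag, Rabs_R0; exact Hd | exact Hz].
Qed.

Lemma ex_RInt_cont (f : R -> R) (a b : R) :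
  (forall x, continuous f x) -> ex_RInt f a b.
Proof. intros H. apply @ex_RInt_continuous. intros; apply H. Qed.

Lemma RInt_abs_le (f q : R -> R) (a b : R) : a <= b ->
  (forall x, continuous f x) -> (forall x, continuous q x) ->
  (forall x, a <= x <= b -> Rabs (f x) <= q x) ->
  Rabs (RInt f a b) <= RInt q a b.
Proof.
  intros Hab Hf Hq H.
  eapply Rle_trans; [apply abs_RInt_le; [exact Hab | apply ex_RInt_cont; exact Hf]|].
  apply RInt_le; [exact Hab | | apply ex_RInt_cont; exact Hq | intros; apply H; lra].
  apply ex_RInt_cont. intros x. apply continuous_comp; [apply Hf | apply continuous_Rabs].
Qed.

Lemma RInt_ext_R (f g : R -> R) (a b : R) :
  (forall x, Rmin a b < x < Rmax a b -> f x = g x :> R) -> RInt f a b = RInt g a b :> R.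
Proof. apply (@RInt_ext R_CompleteNormedModule). Qed.

Lemma RInt_minus_R (f g : R -> R) (a b : R) :
  ex_RInt f a b -> ex_RInt g a b ->
  RInt (fun x => f x - g x) a b = RInt f a b - RInt g a b.
Proof. intros Hf Hg. apply (@RInt_minus R_CompleteNormedModule f g); assumption. Qed.

Lemma RInt_plus_R (f g : R -> R) (a b : R) :
  ex_RInt f a b -> ex_RInt g a b ->
  RInt (fun x => f x + g x) a b = RInt f a b + RInt g a b.
Proof. intros Hf Hg. apply (@RInt_plus R_CompleteNormedModule f g); assumption. Qed.

Lemma RInt_scal_R (f : R -> R) (c a b : R) :
  ex_RInt f a b -> RInt (fun x => c * f x) a b = c * RInt f a b.
Proof. intros Hf. apply (@RInt_scal R_CompleteNormedModule f); assumption. Qed.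

Lemma RInt_const_R (c a b : R) : RInt (fun _ => c) a b = (b - a) * c.
Proof. apply (@RInt_const R_CompleteNormedModule). Qed.

Lemma RInt_Chasles_R (f : R -> R) (a b c : R) : (forall x, continuous f x) ->
  RInt f a b + RInt f b c = RInt f a c.
Proof.
  intros Hf. apply (@RInt_Chasles R_CompleteNormedModule f); apply ex_RInt_cont; exact Hf.
Qed.

Lemma continuous_RInt_param (g : R -> R -> R) (a b x : R) : a <= b ->
  continuous2 g -> continuous (fun x => RInt (fun y => g x y) a b) x.
Proof.
  intros Hab Hg. apply continuity_pt_filterlim. intros eps Heps.
  (* The extra 1 keeps the divisor positive when a = b. *)
  assert (He : 0 < eps / (b - a + 1)) by (apply Rdiv_lt_0_compat; lra).
  destruct (uniform_continuity_2d g (x - 1) (x + 1) a b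
    (fun u v _ _ => continuous2_2d_pt g Hg u v) (mkposreal _ He)) as [d Hd].
  simpl in Hd. pose proof (cond_pos d) as Hd0.
  exists (Rmin d 1). split; [apply Rmin_pos; lra|].
  intros z [_ Hz]. simpl in Hz |- *. unfold R_dist in *.
  assert (Hzd : Rabs (z - x) < d) by (eapply Rlt_le_trans; [exact Hz | apply Rmin_l]).
  assert (Hz1 : Rabs (z - x) < 1) by (eapply Rlt_le_trans; [exact Hz | apply Rmin_r]).
  apply Rabs_def2 in Hz1.
  assert (Hc : forall u y, continuous (fun y => g u y) y)
    by (intros; apply continuous2_snd; exact Hg).
  rewrite <- RInt_minus_R by (apply ex_RInt_cont; intros; apply Hc).
  eapply Rle_lt_trans; [apply RInt_abs_le with (q := fun _ => eps / (b - a + 1))|].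
  - exact Hab.
  - intros y. apply @continuous_minus; apply Hc.
  - intros y. apply continuous_const.
  - intros y Hy. left. apply Hd; try lra; try exact Hzd.
    rewrite Rminus_diag, Rabs_R0; exact Hd0.
  - rewrite RInt_const_R.
    apply Rmult_lt_reg_r with (b - a + 1); [lra|].
    replace ((b - a) * (eps / (b - a + 1)) * (b - a + 1)) with ((b - a) * eps) by (field; lra).
    nra.
Qed.

(** The envelope for all error bounds: its integral over any symmetric interval is at most pi, and
    it changes only by a constant factor under shifts of length at most 1. *)
Definition cauchy (x : R) : R := / (1 + x ^ 2).

Lemma cauchy_pos (x : R) : 0 < cauchy x.
Proof. apply Rinv_0_lt_compat. nra. Qed.

Lemma cauchy_continuous (x : R) : continuous cauchy x.
Proof.
  apply (@ex_derive_continuous R_AbsRing R_NormedModule). unfold cauchy. auto_derive. nra.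
Qed.

Lemma cauchy_int_le (L : R) : RInt cauchy (- L) L <= PI.
Proof.
  replace (RInt cauchy (- L) L) with (atan L - atan (- L)).
  { rewrite atan_opp. pose proof (atan_bound L). lra. }
  symmetry. apply is_RInt_unique.
  apply (is_RInt_derive atan cauchy).
  - intros x _. apply is_derive_Reals.
    apply derivable_pt_lim_atan.
  - intros x _. apply cauchy_continuous.
Qed.

(** * Limits of integrals over growing squares *)

Definition box (g : R -> R -> R) (L : R) : R :=
  RInt (fun x => RInt (fun y => g x y) (- L) L) (- L) L.

Lemma continuous2_plus (f g : R -> R -> R) :
  continuous2 f -> continuous2 g -> continuous2 (fun x y => f x y + g x y).
Proof.
  intros Hf Hg x y eps Heps.
  destruct (Hf x y (eps / 2)) as [d1 [Hd1 H1]]; [lra|].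
  destruct (Hg x y (eps / 2)) as [d2 [Hd2 H2]]; [lra|].
  exists (Rmin d1 d2). split; [apply Rmin_pos; assumption|].
  intros x' y' Hx Hy.
  specialize (H1 x' y' (Rlt_le_trans _ _ _ Hx (Rmin_l _ _)) (Rlt_le_trans _ _ _ Hy (Rmin_l _ _))).
  specialize (H2 x' y' (Rlt_le_trans _ _ _ Hx (Rmin_r _ _)) (Rlt_le_trans _ _ _ Hy (Rmin_r _ _))).
  replace (f x' y' + g x' y' - (f x y + g x y))
    with ((f x' y' - f x y) + (g x' y' - g x y)) by ring.
  eapply Rle_lt_trans; [apply Rabs_triang | lra].
Qed.

Lemma continuous2_of_2d_pt (g : R -> R -> R) :
  (forall x y, continuity_2d_pt g x y) -> continuous2 g.
Proof.
  intros H x y eps Heps. destruct (H x y (mkposreal eps Heps)) as [d Hd].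
  exists d. split; [apply cond_pos | exact Hd].
Qed.

Lemma continuous2_mult (f g : R -> R -> R) :
  continuous2 f -> continuous2 g -> continuous2 (fun x y => f x y * g x y).
Proof.
  intros Hf Hg. apply continuous2_of_2d_pt. intros x y.
  apply continuity_2d_pt_mult; apply continuous2_2d_pt; assumption.
Qed.

Lemma continuous2_cauchy (c : R) : continuous2 (fun x y => c * (cauchy x * cauchy y)).
Proof.
  assert (H : forall x, continuity_pt cauchy x)
    by (intros; apply continuity_pt_filterlim, cauchy_continuous).
  apply continuous2_of_2d_pt. intros x y.
  apply continuity_2d_pt_mult; [apply continuity_2d_pt_const|].
  apply continuity_2d_pt_mult.
  - apply (continuity_1d_2d_pt_comp cauchy (fun u _ => u)); [apply H | apply continuity_2d_pt_id1].
  - apply (continuity_1d_2d_pt_comp cauchy (fun _ v => v)); [apply H | apply continuity_2d_pt_id2].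
Qed.

Section Box.

Variable g : R -> R -> R.
Hypothesis Hg : continuous2 g.

Lemma box_inner_cont (L x : R) : 0 <= L ->
  continuous (fun x => RInt (fun y => g x y) (- L) L) x.
Proof. intros HL. apply continuous_RInt_param; [lra | exact Hg]. Qed.

Lemma box_le_cauchy (c L : R) : 0 <= c -> 0 <= L ->
  (forall x y, Rabs (g x y) <= c * (cauchy x * cauchy y)) ->
  Rabs (box g L) <= c * PI ^ 2.
Proof.
  intros Hc HL H. pose proof PI_RGT_0.
  apply Rle_trans with (RInt (fun x => (c * PI) * cauchy x) (- L) L).
  - apply RInt_abs_le; [lra | intros; apply box_inner_cont; lra | |].
    { intros x. apply @continuous_scal_r, cauchy_continuous. }
    intros x _.
    apply Rle_trans with (RInt (fun y => (c * cauchy x) * cauchy y) (- L) L).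
    + apply RInt_abs_le; [lra | intros; apply continuous2_snd; exact Hg | |].
      { intros y. apply @continuous_scal_r, cauchy_continuous. }
      intros y _. rewrite Rmult_assoc. apply H.
    + rewrite RInt_scal_R by (apply ex_RInt_cont, cauchy_continuous).
      replace (c * PI * cauchy x) with (c * cauchy x * PI) by ring.
      apply Rmult_le_compat_l; [| apply cauchy_int_le].
      apply Rmult_le_pos; [exact Hc | left; apply cauchy_pos].
  - rewrite RInt_scal_R by (apply ex_RInt_cont, cauchy_continuous).
    replace (c * PI ^ 2) with (c * PI * PI) by ring.
    apply Rmult_le_compat_l; [nra | apply cauchy_int_le].
Qed.

Lemma box_monotone (L M : R) : 0 <= L <= M -> (forall x y, 0 <= g x y) ->
  box g L <= box g M.
Proof.
  intros HLM H.
  assert (Hcy : forall x y, continuous (fun y => g x y) y)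
    by (intros; apply continuous2_snd; exact Hg).
  assert (Hwide : forall phi : R -> R, (forall x, continuous phi x) -> (forall x, 0 <= phi x) ->
            RInt phi (- L) L <= RInt phi (- M) M).
  { intros phi Hc Hp.
    rewrite <- (RInt_Chasles_R phi (- M) (- L) M Hc), <- (RInt_Chasles_R phi (- L) L M Hc).
    assert (0 <= RInt phi (- M) (- L))
      by (apply RInt_ge_0; [lra | apply ex_RInt_cont; exact Hc | intros; apply Hp]).
    assert (0 <= RInt phi L M)
      by (apply RInt_ge_0; [lra | apply ex_RInt_cont; exact Hc | intros; apply Hp]).
    lra. }
  unfold box. eapply Rle_trans.
  - apply RInt_le with (g := fun x => RInt (fun y => g x y) (- M) M); [lra | | |].
    + apply ex_RInt_cont; intros; apply box_inner_cont; lra.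
    + apply ex_RInt_cont; intros; apply box_inner_cont; lra.
    + intros x _. apply Hwide; [apply Hcy | apply H].
  - apply Hwide; [intros; apply box_inner_cont; lra|].
    intros x. apply RInt_ge_0; [lra | apply ex_RInt_cont, Hcy | intros; apply H].
Qed.

Lemma integral_R2_of_box (v : R) :
  (forall eps, 0 < eps -> exists L0, forall L, L0 <= L -> Rabs (box g L - v) < eps) ->
  integral_R2 g v.
Proof.
  intros H eps Heps. destruct (H eps Heps) as [L0 HL0].
  exists (Rmax 0 L0). intros L HL.
  assert (0 <= L) by (eapply Rle_trans; [apply Rmax_l | exact HL]).
  assert (L0 <= L) by (eapply Rle_trans; [apply Rmax_r | exact HL]).
  exists (fun x => RInt (fun y => g x y) (- L) L), (box g L).
  repeat split.
  - intros x.
    exists (ex_RInt_Reals_0 _ _ _ (ex_RInt_cont _ (- L) L (fun y => continuous2_snd g x y Hg))).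
    symmetry; apply RInt_Reals.
  - exists (ex_RInt_Reals_0 _ _ _ (ex_RInt_cont _ (- L) L (fun x => box_inner_cont L x H0))).
    symmetry; apply RInt_Reals.
  - apply HL0; assumption.
Qed.

End Box.

Lemma box_plus (f g : R -> R -> R) (L : R) : 0 <= L -> continuous2 f -> continuous2 g ->
  box (fun x y => f x y + g x y) L = box f L + box g L.
Proof.
  intros HL Hf Hg. unfold box.
  rewrite <- RInt_plus_R
    by (apply ex_RInt_cont; intros; apply continuous_RInt_param; [lra | assumption]).
  apply RInt_ext; intros x _.
  apply RInt_plus_R; apply ex_RInt_cont; intros; apply continuous2_snd; assumption.
Qed.

(** For nonnegative [g] the integral increases with the square and is bounded by c pi^2, so its
    supremum is the limit. *)
Lemma box_cv_nonneg (g : R -> R -> R) (c : R) : continuous2 g -> 0 <= c ->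
  (forall x y, 0 <= g x y <= c * (cauchy x * cauchy y)) ->
  exists v, forall eps, 0 < eps ->
    exists L0, 0 <= L0 /\ forall L, L0 <= L -> Rabs (box g L - v) < eps.
Proof.
  intros Hg Hc H.
  destruct (completeness (fun b => exists L, 0 <= L /\ b = box g L)) as [v [Hub Hlub]].
  - exists (c * PI ^ 2). intros b [L [HL ->]].
    eapply Rle_trans; [apply Rle_abs | apply box_le_cauchy; try assumption].
    intros x y. rewrite Rabs_pos_eq; apply H.
  - exists (box g 0), 0. split; [lra | reflexivity].
  - exists v. intros eps Heps.
    assert (Hex : exists L0, 0 <= L0 /\ v - eps < box g L0).
    { apply Classical_Prop.NNPP. intros Hno.
      assert (v <= v - eps); [|lra]. apply Hlub. intros b [L [HL ->]].
      apply Rnot_lt_le. intros Hlt. apply Hno. exists L; split; assumption. }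
    destruct Hex as [L0 [HL0 Hv]]. exists L0; split; [exact HL0|]. intros L HL.
    assert (box g L <= v) by (apply Hub; exists L; split; [lra | reflexivity]).
    assert (box g L0 <= box g L)
      by (apply box_monotone; [exact Hg | lra | intros; apply H]).
    apply Rabs_def1; lra.
Qed.

(** Adding the envelope makes the integrand nonnegative; the limit for the envelope alone is then
    subtracted. *)
Lemma box_cv (g : R -> R -> R) (c : R) : continuous2 g -> 0 <= c ->
  (forall x y, Rabs (g x y) <= c * (cauchy x * cauchy y)) ->
  exists v, forall eps, 0 < eps ->
    exists L0, forall L, L0 <= L -> Rabs (box g L - v) < eps.
Proof.
  intros Hg Hc H.
  pose proof (continuous2_cauchy c) as Hk.
  destruct (box_cv_nonneg (fun x y => g x y + c * (cauchy x * cauchy y)) (2 * c))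
    as [v1 H1].
  - apply continuous2_plus; assumption.
  - lra.
  - intros x y. specialize (H x y). apply Rabs_le_between in H. lra.
  - destruct (box_cv_nonneg (fun x y => c * (cauchy x * cauchy y)) c) as [v2 H2].
    + exact Hk.
    + exact Hc.
    + intros x y. split; [|lra]. eapply Rle_trans; [apply Rabs_pos | apply H].
    + exists (v1 - v2). intros eps Heps.
      destruct (H1 (eps / 2)) as [L1 [HL1 HH1]]; [lra|].
      destruct (H2 (eps / 2)) as [L2 [HL2 HH2]]; [lra|].
      exists (Rmax L1 L2). intros L HL.
      pose proof (Rle_trans _ _ _ (Rmax_l _ _) HL) as Hl1.
      pose proof (Rle_trans _ _ _ (Rmax_r _ _) HL) as Hl2.
      specialize (HH1 L Hl1). specialize (HH2 L Hl2).
      rewrite box_plus in HH1 by (assumption || lra).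
      apply Rabs_def2 in HH1. apply Rabs_def2 in HH2. apply Rabs_def1; lra.
Qed.

(** The error [q] varies with the position, so that the cell errors add up to an integral of [q]
    instead of growing with the number of cells. The values [a k] are not tied to [phi] at a point:
    in [grid_sum] they are themselves inner sums. *)
Lemma cell_sum (a : nat -> R) (phi q : R -> R) (h x0 : R) (n : nat) : 0 <= h ->
  (forall x, continuous phi x) -> (forall x, continuous q x) ->
  (forall k x, (k <= n)%nat -> x0 + INR k * h <= x <= x0 + INR (S k) * h ->
     Rabs (a k - phi x) <= q x) ->
  Rabs (h * sum_f_R0 a n - RInt phi x0 (x0 + INR (S n) * h)) <=
  RInt q x0 (x0 + INR (S n) * h).
Proof.
  intros Hh Hphi Hq.
  assert (Hcell : forall k, (forall x, x0 + INR k * h <= x <= x0 + INR (S k) * h ->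
      Rabs (a k - phi x) <= q x) ->
    Rabs (h * a k - RInt phi (x0 + INR k * h) (x0 + INR (S k) * h)) <=
    RInt q (x0 + INR k * h) (x0 + INR (S k) * h)).
  { intros k Hk.
    assert (Ha : h * a k = RInt (fun _ => a k) (x0 + INR k * h) (x0 + INR (S k) * h))
      by (rewrite RInt_const_R, S_INR; ring).
    rewrite Ha.
    rewrite <- RInt_minus_R
      by (apply ex_RInt_cont; first [exact Hphi | intros; apply continuous_const]).
    apply RInt_abs_le; [rewrite S_INR; nra | | exact Hq | exact Hk].
    intros x. apply @continuous_minus; [apply continuous_const | apply Hphi]. }
  induction n as [|n IH]; intros H.
  - specialize (Hcell 0%nat (fun x => H 0%nat x (le_n _))).
    simpl INR in *. rewrite Rmult_0_l, Rplus_0_r in Hcell. exact Hcell.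
  - rewrite tech5.
    rewrite <- (RInt_Chasles_R phi x0 (x0 + INR (S n) * h)) by exact Hphi.
    rewrite <- (RInt_Chasles_R q x0 (x0 + INR (S n) * h)) by exact Hq.
    specialize (IH (fun k x Hk => H k x (le_S _ _ Hk))).
    specialize (Hcell (S n) (fun x => H (S n) x (le_n _))).
    match goal with |- Rabs ?e <= _ => replace e with
      ((h * sum_f_R0 a n - RInt phi x0 (x0 + INR (S n) * h)) +
       (h * a (S n) - RInt phi (x0 + INR (S n) * h) (x0 + INR (S (S n)) * h))) by ring end.
    eapply Rle_trans; [apply Rabs_triang | lra].
Qed.

(** [cell_sum] in y, then in x: the inner error integrates to at most e pi [cauchy] x, which is the
    [q] of the outer application. *)
Lemma grid_sum (a : nat -> nat -> R) (g : R -> R -> R) (h e : R) (n : nat) :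
  0 <= h -> 0 <= e -> continuous2 g ->
  let L := INR (S n) * h / 2 in
  (forall k l x y, (k <= n)%nat -> (l <= n)%nat ->
     - L + INR k * h <= x <= - L + INR (S k) * h ->
     - L + INR l * h <= y <= - L + INR (S l) * h ->
     Rabs (a k l - g x y) <= e * (cauchy x * cauchy y)) ->
  Rabs (h * sum_f_R0 (fun k => h * sum_f_R0 (a k) n) n - box g L) <= e * PI ^ 2.
Proof.
  intros Hh He Hg L H.
  assert (HL : 0 <= L) by (unfold L; pose proof (pos_INR (S n)); nra).
  assert (HLe : - L + INR (S n) * h = L) by (unfold L; field).
  pose proof PI_RGT_0.
  eapply Rle_trans.
  - assert (Hbox : box g L =
      RInt (fun x => RInt (fun y => g x y) (- L) L) (- L) (- L + INR (S n) * h))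
      by (rewrite HLe; reflexivity).
    rewrite Hbox.
    apply (cell_sum _ _ (fun x => e * PI * cauchy x)).
    + exact Hh.
    + intros; apply box_inner_cont; assumption.
    + intros x. apply @continuous_scal_r, cauchy_continuous.
    + intros k x Hk Hx.
      assert (Hin : RInt (fun y => g x y) (- L) L =
        RInt (fun y => g x y) (- L) (- L + INR (S n) * h))
        by (rewrite HLe; reflexivity).
      rewrite Hin. eapply Rle_trans.
      * apply (cell_sum _ (fun y => g x y) (fun y => e * cauchy x * cauchy y)).
        -- exact Hh.
        -- intros; apply continuous2_snd; exact Hg.
        -- intros y. apply @continuous_scal_r, cauchy_continuous.
        -- intros l y Hl Hy. rewrite Rmult_assoc. apply H; assumption.
      * rewrite HLe, RInt_scal_R by (apply ex_RInt_cont, cauchy_continuous).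
        replace (e * PI * cauchy x) with (e * cauchy x * PI) by ring.
        apply Rmult_le_compat_l; [| apply cauchy_int_le].
        apply Rmult_le_pos; [exact He | left; apply cauchy_pos].
  - rewrite HLe, RInt_scal_R by (apply ex_RInt_cont, cauchy_continuous).
    replace (e * PI ^ 2) with (e * PI * PI) by ring.
    apply Rmult_le_compat_l; [nra | apply cauchy_int_le].
Qed.

(** * The Gaussian integral *)

(** The quartic term is there for the kernel exp(-x^2 (1 + t^2)) of [gker]; with d = 0 the lemma
    covers the quadratic forms. *)
Lemma continuity_2d_pt_poly_exp (a b c d x y : R) :
  continuity_2d_pt (fun u v => exp (a * (u * u) + b * (u * v) + c * (v * v)
                                    + d * (u * u * (v * v)))) x y.
Proof.
  apply (continuity_1d_2d_pt_comp exp).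
  - apply derivable_continuous_pt, derivable_pt_exp.
  - repeat first [ apply continuity_2d_pt_plus | apply continuity_2d_pt_mult
                 | apply continuity_2d_pt_const | apply continuity_2d_pt_id1
                 | apply continuity_2d_pt_id2 ].
Qed.

Lemma is_derive_0_const (f : R -> R) (x : R) :
  (forall t, is_derive f t 0) -> f x = f 0.
Proof.
  intros H. destruct (MVT_gen f 0 x (fun _ => 0)) as [c [_ Hc]].
  - intros; apply H.
  - intros y _. apply derivable_continuous_pt, ex_derive_Reals_0. exists 0. apply H.
  - lra.
Qed.

Definition gauss (t : R) : R := exp (- t ^ 2).

Lemma gauss_continuous (x : R) : continuous gauss x.
Proof.
  apply (@ex_derive_continuous R_AbsRing R_NormedModule). unfold gauss. auto_derive. trivial.
Qed.

Definition gauss_prim (x : R) : R := RInt gauss 0 x.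

Lemma gauss_prim_derive (x : R) : is_derive gauss_prim x (gauss x).
Proof.
  apply (is_derive_RInt gauss gauss_prim 0).
  - apply filter_forall. intros y. apply (@RInt_correct R_CompleteNormedModule).
    apply ex_RInt_cont, gauss_continuous.
  - apply gauss_continuous.
Qed.

Lemma gauss_prim_0 : gauss_prim 0 = 0.
Proof. apply (@RInt_point R_CompleteNormedModule). Qed.

Lemma gauss_prim_diff (x y : R) : RInt gauss x y = gauss_prim y - gauss_prim x :> R.
Proof.
  pose proof (RInt_Chasles_R gauss 0 x y gauss_continuous) as H.
  fold (gauss_prim x) (gauss_prim y) in H. lra.
Qed.

Lemma gauss_prim_le (x y : R) : x <= y -> gauss_prim x <= gauss_prim y.
Proof.
  intros H. assert (0 <= RInt gauss x y).
  { apply RInt_ge_0; [exact H | apply ex_RInt_cont, gauss_continuous|].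
    intros; left; apply exp_pos. }
  rewrite gauss_prim_diff in H0. lra.
Qed.

Lemma gauss_prim_nonneg (x : R) : 0 <= x -> 0 <= gauss_prim x.
Proof. intros H. rewrite <- gauss_prim_0. apply gauss_prim_le, H. Qed.

Lemma RInt_gauss_affine (a s x y : R) : 0 < a ->
  RInt (fun z => exp (- (a * (z - s)) ^ 2)) x y = (gauss_prim (a * (y - s)) - gauss_prim (a * (x - s))) / a :> R.
Proof.
  intros Ha.
  assert (Hc : forall z, continuous (fun z => exp (- (a * (z - s)) ^ 2)) z).
  { intros z. apply (@ex_derive_continuous R_AbsRing R_NormedModule). auto_derive. trivial. }
  pose proof (@RInt_comp_lin R_CompleteNormedModule gauss a (- (a * s)) x y
                (ex_RInt_cont _ _ _ gauss_continuous)) as H.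
  rewrite gauss_prim_diff in H.
  rewrite (RInt_ext_R _ (fun z => a * exp (- (a * (z - s)) ^ 2))) in H.
  2:{ intros z _. unfold scal; simpl; unfold mult; simpl; unfold gauss.
      f_equal. f_equal. ring. }
  rewrite RInt_scal_R in H by (apply ex_RInt_cont; exact Hc).
  replace (a * (y - s)) with (a * y + - (a * s)) by ring.
  replace (a * (x - s)) with (a * x + - (a * s)) by ring.
  apply (Rmult_eq_reg_l a); [|lra]. rewrite H. field. lra.
Qed.

Lemma gauss_prim_opp (x : R) : gauss_prim (- x) = - gauss_prim x.
Proof.
  assert (H : forall t, is_derive (fun t => gauss_prim (- t) + gauss_prim t) t 0).
  { intros t.
    assert (H1 : is_derive (fun t => gauss_prim (- t)) t (- gauss (- t))).
    { replace (- gauss (- t)) with (scal (-1) (gauss (- t)))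
        by (unfold scal; simpl; unfold mult; simpl; ring).
      apply (is_derive_comp gauss_prim Ropp t); [apply gauss_prim_derive|]. auto_derive; [trivial | ring]. }
    replace 0 with (plus (- gauss (- t)) (gauss t))
      by (unfold plus; simpl; unfold gauss; replace ((- t) ^ 2) with (t ^ 2) by ring; ring).
    apply (is_derive_plus _ _ _ _ _ H1 (gauss_prim_derive t)). }
  pose proof (is_derive_0_const _ x H) as Hc. cbv beta in Hc.
  rewrite Ropp_0, gauss_prim_0 in Hc. lra.
Qed.

(** The classical companion of the Gaussian primitive F: with G this function, F^2 + G is constant,
    G(0) = atan 1 = pi/4, and G vanishes at infinity. *)
Definition gker (x : R) : R :=
  RInt (fun t => exp (- (x ^ 2 * (1 + t ^ 2))) / (1 + t ^ 2)) 0 1.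

Lemma gker_cont (x t : R) :
  continuous (fun t => exp (- (x ^ 2 * (1 + t ^ 2))) / (1 + t ^ 2)) t.
Proof.
  apply (@ex_derive_continuous R_AbsRing R_NormedModule). auto_derive. nra.
Qed.

(** Differentiating under the integral cancels the denominator, and s = x t turns the rest into
    [gauss_prim]. *)
Lemma gker_derive (x : R) : is_derive gker x (- (2 * gauss x * gauss_prim x)).
Proof.
  assert (HD : forall u t, is_derive (fun z => exp (- (z ^ 2 * (1 + t ^ 2))) / (1 + t ^ 2)) u
                             (- 2 * u * exp (- (u ^ 2 * (1 + t ^ 2))))).
  { intros u t. auto_derive; [nra|].
    replace (u * (u * 1) * (1 + t * (t * 1))) with (u ^ 2 * (1 + t ^ 2)) by ring. field. nra. }
  assert (HD' : forall u t : R, Derive (fun z : R => exp (- (z ^ 2 * (1 + t ^ 2))) / (1 + t ^ 2)) u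
                              = - 2 * u * exp (- (u ^ 2 * (1 + t ^ 2))))
    by (intros; apply is_derive_unique, HD).
  assert (Heq : RInt (fun t => Derive (fun u => exp (- (u ^ 2 * (1 + t ^ 2))) / (1 + t ^ 2)) x) 0 1
                = - (2 * gauss x * gauss_prim x) :> R).
  (* The term [x * t + 0] has the shape required by [RInt_comp_lin], whose form of the substitution
     also holds at x = 0. *)
  { rewrite (RInt_ext_R _ (fun t => (- 2 * gauss x) * (x * gauss (x * t + 0)))).
    2:{ intros t _. rewrite HD'. unfold gauss.
        replace (- (x ^ 2 * (1 + t ^ 2))) with (- x ^ 2 + - (x * t + 0) ^ 2) by ring.
        rewrite exp_plus. ring. }
    rewrite RInt_scal_R.
    - pose proof (@RInt_comp_lin R_CompleteNormedModule gauss x 0 0 1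
                    (ex_RInt_cont _ _ _ gauss_continuous)) as H.
      unfold scal in H; simpl in H; unfold mult in H; simpl in H.
      rewrite H. rewrite Rmult_0_r, Rmult_1_r, !Rplus_0_r. fold (gauss_prim x). ring.
    - apply ex_RInt_cont. intros t.
      apply (@ex_derive_continuous R_AbsRing R_NormedModule). unfold gauss. auto_derive. trivial. }
  rewrite <- Heq. apply (is_derive_RInt_param
    (fun x t => exp (- (x ^ 2 * (1 + t ^ 2))) / (1 + t ^ 2)) 0 1 x).
  - apply filter_forall. intros u t _. eexists; apply HD.
  - intros t _.
    apply continuity_2d_pt_ext with
      (fun u v => (-2 * u) * exp ((-1) * (u * u) + 0 * (u * v) + 0 * (v * v)
                                    + (-1) * (u * u * (v * v)))).
    + intros u v. rewrite HD'. f_equal. f_equal. ring.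
    + apply continuity_2d_pt_mult; [| apply continuity_2d_pt_poly_exp].
      apply continuity_2d_pt_mult; [apply continuity_2d_pt_const | apply continuity_2d_pt_id1].
  - apply filter_forall. intros u. apply ex_RInt_cont, gker_cont.
Qed.

Lemma gker_0 : gker 0 = PI / 4.
Proof.
  unfold gker. rewrite <- atan_1.
  replace (atan 1) with (atan 1 - atan 0) by (rewrite atan_0; ring).
  rewrite (RInt_ext_R _ cauchy).
  2:{ intros t _. replace (- (0 ^ 2 * (1 + t ^ 2))) with 0 by ring.
      rewrite exp_0. unfold cauchy, Rdiv. ring. }
  apply is_RInt_unique. apply (is_RInt_derive atan cauchy).
  - intros x _. apply is_derive_Reals, derivable_pt_lim_atan.
  - intros x _. apply cauchy_continuous.
Qed.

Lemma gauss_prim_gker (x : R) : gauss_prim x ^ 2 + gker x = PI / 4.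
Proof.
  assert (H : forall t, is_derive (fun t => gauss_prim t * gauss_prim t + gker t) t 0).
  { intros t.
    replace 0 with (plus (plus (mult (gauss t) (gauss_prim t)) (mult (gauss_prim t) (gauss t)))
                         (- (2 * gauss t * gauss_prim t)))
      by (unfold plus, mult; simpl; ring).
    apply (is_derive_plus (fun t => gauss_prim t * gauss_prim t) gker); [|apply gker_derive].
    apply (is_derive_mult gauss_prim gauss_prim); [apply gauss_prim_derive | apply gauss_prim_derive |].
    intros; unfold mult; simpl; ring. }
  pose proof (is_derive_0_const _ x H) as Hc. cbv beta in Hc.
  rewrite gauss_prim_0, gker_0 in Hc. lra.
Qed.

Lemma gker_bounds (x : R) : 0 <= gker x <= gauss x.
Proof.
  split.
  - apply RInt_ge_0; [lra | apply ex_RInt_cont, gker_cont|].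
    intros t _. left. apply Rdiv_lt_0_compat; [apply exp_pos | nra].
  - replace (gauss x) with ((1 - 0) * gauss x) by ring. rewrite <- RInt_const_R.
    apply RInt_le; [lra | apply ex_RInt_cont, gker_cont | apply ex_RInt_cont; intros; apply continuous_const|].
    intros t _. unfold gauss.
    apply Rmult_le_reg_r with (1 + t ^ 2); [nra|].
    replace (exp (- (x ^ 2 * (1 + t ^ 2))) / (1 + t ^ 2) * (1 + t ^ 2))
      with (exp (- (x ^ 2 * (1 + t ^ 2)))) by (field; nra).
    replace (- (x ^ 2 * (1 + t ^ 2))) with (- x ^ 2 + - (x * t) ^ 2) by ring.
    rewrite exp_plus. apply Rmult_le_compat_l; [left; apply exp_pos|].
    apply Rle_trans with 1; [|nra].
    rewrite <- exp_0. apply exp_nondecr. nra.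
Qed.

Lemma gauss_prim_sq_bounds (x : R) : PI / 4 - gauss x <= gauss_prim x ^ 2 <= PI / 4.
Proof. pose proof (gauss_prim_gker x). pose proof (gker_bounds x). lra. Qed.

(** * The bivariate Gaussian integral over squares *)

Definition quad (a b x y : R) : R := a * (x * x) + (- 2 * b) * (x * y) + a * (y * y).

Lemma continuous2_exp_quad (a b : R) : continuous2 (fun x y => exp (- quad a b x y)).
Proof.
  apply continuous2_of_2d_pt. intros x y.
  apply continuity_2d_pt_ext with
    (fun u v => exp ((- a) * (u * u) + (2 * b) * (u * v) + (- a) * (v * v)
                     + 0 * (u * u * (v * v)))); [| apply continuity_2d_pt_poly_exp].
  intros u v. f_equal. unfold quad. ring.
Qed.

Section GaussBox.

Variables a b : R.
Hypothesis Hab : 0 <= b < a.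

(** Completing the square gives quad = a (y - t x)^2 + c x^2. For |x| <= L the shifted range of y -
    t x still contains [-(1-t)L, (1-t)L], so [kappa * L] bounds from below the scaled half widths in
    both directions. *)
Let t := b / a.
Let c := a - b ^ 2 / a.
Let kappa := Rmin (sqrt a * (1 - t)) (sqrt c).

Lemma shear_bounds : 0 <= t < 1.
Proof.
  unfold t. split; [apply Rdiv_le_0_compat; lra|].
  apply Rmult_lt_reg_r with a; [lra|]. unfold Rdiv. rewrite Rmult_assoc, Rinv_l; lra.
Qed.

Lemma schur_complement_pos : 0 < c.
Proof.
  unfold c. apply Rmult_lt_reg_r with a; [lra|].
  replace ((a - b ^ 2 / a) * a) with (a ^ 2 - b ^ 2) by (field; lra). nra.
Qed.

Lemma sqrt_det : sqrt (a ^ 2 - b ^ 2) = sqrt a * sqrt c.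
Proof.
  rewrite <- sqrt_mult; [| lra | left; apply schur_complement_pos]. f_equal. unfold c. field. lra.
Qed.

Lemma inner_gauss (L x : R) :
  RInt (fun y => exp (- quad a b x y)) (- L) L =
  gauss (sqrt c * x) * ((gauss_prim (sqrt a * (L - t * x)) + gauss_prim (sqrt a * (L + t * x))) / sqrt a) :> R.
Proof.
  assert (Ha : 0 < sqrt a) by (apply sqrt_lt_R0; lra).
  assert (Hc2 : sqrt c ^ 2 = c) by (apply pow2_sqrt; left; apply schur_complement_pos).
  assert (Ha2 : sqrt a ^ 2 = a) by (apply pow2_sqrt; lra).
  rewrite (RInt_ext_R _ (fun y => gauss (sqrt c * x) * exp (- (sqrt a * (y - t * x)) ^ 2))).
  - rewrite RInt_scal_R, RInt_gauss_affine; [| exact Ha |].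
    + replace (sqrt a * (- L - t * x)) with (- (sqrt a * (L + t * x))) by ring.
      rewrite gauss_prim_opp. f_equal. f_equal. ring.
    + apply ex_RInt_cont. intros y.
      apply (@ex_derive_continuous R_AbsRing R_NormedModule). auto_derive. trivial.
  - intros y _. unfold gauss. rewrite <- exp_plus. f_equal.
    rewrite !Rpow_mult_distr, Hc2, Ha2. unfold quad, c, t. field. lra.
Qed.

Lemma kappa_pos : 0 < kappa.
Proof.
  apply Rmin_pos; [|apply sqrt_lt_R0, schur_complement_pos].
  apply Rmult_lt_0_compat; [apply sqrt_lt_R0; lra | pose proof shear_bounds; lra].
Qed.

(** With u = sqrt(pi)/2 bounding F = [gauss_prim] and m = F(kappa L), the inner integral lies
    between 2m/sqrt(a) and 2u/sqrt(a) times a Gaussian in x, whose integral is 2I/sqrt(c) with m <=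
    I <= u. The lower bound then uses 4mI >= 4m^2 >= pi - 4 [gauss] (kappa L). *)
Lemma box_gauss_bounds (L : R) : 0 <= L ->
  (PI - 4 * gauss (kappa * L)) / sqrt (a ^ 2 - b ^ 2)
  <= box (fun x y => exp (- quad a b x y)) L <= PI / sqrt (a ^ 2 - b ^ 2).
Proof.
  intros HL.
  assert (Ha : 0 < sqrt a) by (apply sqrt_lt_R0; lra).
  assert (Hc : 0 < sqrt c) by (apply sqrt_lt_R0, schur_complement_pos).
  pose proof shear_bounds as Ht. pose proof kappa_pos as Hk. pose proof PI_RGT_0 as Hpi.
  set (u := sqrt PI / 2).
  assert (Hu : u ^ 2 = PI / 4).
  { unfold u. unfold Rdiv. rewrite Rpow_mult_distr, pow2_sqrt by lra. field. }
  assert (Hu0 : 0 < u) by (apply Rdiv_lt_0_compat; [apply sqrt_lt_R0; exact Hpi | lra]).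
  assert (Hgiu : forall z, gauss_prim z <= u).
  { intros z. pose proof (gauss_prim_sq_bounds z). nra. }
  set (m := gauss_prim (kappa * L)).
  assert (Hm : 0 <= m) by (apply gauss_prim_nonneg, Rmult_le_pos; lra).
  set (I := gauss_prim (sqrt c * L)).
  assert (HmI : m <= I).
  { apply gauss_prim_le, Rmult_le_compat_r; [exact HL | apply Rmin_r]. }
  assert (HI : RInt (fun x => gauss (sqrt c * x)) (- L) L = 2 * I / sqrt c :> R).
  { rewrite (RInt_ext_R _ (fun x => exp (- (sqrt c * (x - 0)) ^ 2)))
      by (intros; unfold gauss; f_equal; ring).
    rewrite RInt_gauss_affine by exact Hc.
    replace (sqrt c * (- L - 0)) with (- (sqrt c * L)) by ring.
    rewrite gauss_prim_opp, Rminus_0_r. fold I. field. lra. }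
  assert (Hgc : forall k x, continuous (fun x => k * gauss (sqrt c * x)) x).
  { intros k x. apply (@ex_derive_continuous R_AbsRing R_NormedModule).
    unfold gauss. auto_derive. trivial. }
  assert (Hbox : forall k, ex_RInt (fun x => k * gauss (sqrt c * x)) (- L) L)
    by (intros; apply ex_RInt_cont, Hgc).
  assert (HkI : forall k, RInt (fun x => k * gauss (sqrt c * x)) (- L) L = k * (2 * I / sqrt c) :> R).
  { intros k. rewrite RInt_scal_R, HI; [reflexivity|].
    apply ex_RInt_cont. intros x. apply (@ex_derive_continuous R_AbsRing R_NormedModule).
    unfold gauss. auto_derive. trivial. }
  assert (Hinner : forall x, - L < x < L ->
    2 * m / sqrt a * gauss (sqrt c * x) <= RInt (fun y => exp (- quad a b x y)) (- L) L
      <= 2 * u / sqrt a * gauss (sqrt c * x)).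
  { intros x Hx. rewrite inner_gauss.
    assert (Hlow : forall z, L - t * L <= z -> m <= gauss_prim (sqrt a * z)).
    { intros z Hz. apply gauss_prim_le.
      apply Rle_trans with (sqrt a * (1 - t) * L).
      - apply Rmult_le_compat_r; [exact HL | apply Rmin_l].
      - rewrite Rmult_assoc. apply Rmult_le_compat_l; lra. }
    pose proof (exp_pos (- (sqrt c * x) ^ 2)) as Hg. change (0 < gauss (sqrt c * x)) in Hg.
    rewrite !(Rmult_comm (gauss _)). unfold Rdiv.
    pose proof (Rinv_0_lt_compat _ Ha).
    split; (apply Rmult_le_compat_r; [lra|]); (apply Rmult_le_compat_r; [lra|]).
    - pose proof (Hlow (L - t * x)). pose proof (Hlow (L + t * x)). nra.
    - pose proof (Hgiu (sqrt a * (L - t * x))). pose proof (Hgiu (sqrt a * (L + t * x))). lra. }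
  rewrite sqrt_det.
  assert (Hin : ex_RInt (fun x => RInt (fun y => exp (- quad a b x y)) (- L) L) (- L) L).
  { apply ex_RInt_cont. intros. apply box_inner_cont; [apply continuous2_exp_quad | exact HL]. }
  assert (Hac : 0 < / (sqrt a * sqrt c)) by (apply Rinv_0_lt_compat, Rmult_lt_0_compat; lra).
  split.
  - apply Rle_trans with (2 * m / sqrt a * (2 * I / sqrt c)).
    + replace (2 * m / sqrt a * (2 * I / sqrt c)) with (4 * (m * I) * / (sqrt a * sqrt c))
        by (field; split; lra).
      apply Rmult_le_compat_r; [lra|].
      pose proof (gauss_prim_sq_bounds (kappa * L)) as Hs. fold m in Hs. nra.
    + rewrite <- HkI. apply RInt_le; [lra | apply Hbox | exact Hin |].
      intros x Hx. apply Hinner, Hx.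
  - apply Rle_trans with (2 * u / sqrt a * (2 * I / sqrt c)).
    + rewrite <- HkI. apply RInt_le; [lra | exact Hin | apply Hbox |].
      intros x Hx. apply Hinner, Hx.
    + replace (2 * u / sqrt a * (2 * I / sqrt c)) with (4 * (u * I) * / (sqrt a * sqrt c))
        by (field; split; lra).
      apply Rmult_le_compat_r; [lra|].
      pose proof (Hgiu (sqrt c * L)) as HIu. fold I in HIu. nra.
Qed.

Lemma box_gauss_cv (eps : R) : 0 < eps -> exists L0, forall L, L0 <= L ->
  Rabs (box (fun x y => exp (- quad a b x y)) L - PI / sqrt (a ^ 2 - b ^ 2)) < eps.
Proof.
  intros Heps.
  assert (Hd : 0 < sqrt (a ^ 2 - b ^ 2)) by (apply sqrt_lt_R0; nra).
  set (d := sqrt (a ^ 2 - b ^ 2)) in *.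
  pose proof kappa_pos as Hk.
  (* Chosen so that 4/(K d) = eps; for kappa L >= K one has exp((kappa L)^2) >= 1 + K^2 > K. *)
  set (K := 4 / (d * eps)).
  assert (HK : 0 < K) by (apply Rdiv_lt_0_compat; nra).
  exists (K / kappa). intros L HL.
  assert (HKL : K <= kappa * L).
  { apply (Rmult_le_compat_l kappa) in HL; [|lra].
    replace (kappa * (K / kappa)) with K in HL by (field; lra). exact HL. }
  assert (HL0 : 0 <= L) by nra.
  pose proof (box_gauss_bounds L HL0) as Hb. fold d in Hb.
  assert (Hg : 4 * gauss (kappa * L) / d < eps).
  { unfold gauss. rewrite exp_Ropp.
    pose proof (exp_ineq1_le ((kappa * L) ^ 2)).
    assert (K < exp ((kappa * L) ^ 2)) by nra.
    apply Rlt_le_trans with (4 * / K / d).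
    - apply Rmult_lt_compat_r; [apply Rinv_0_lt_compat; exact Hd|].
      apply Rmult_lt_compat_l; [lra|]. apply Rinv_lt_contravar; [|assumption].
      apply Rmult_lt_0_compat; [exact HK | apply exp_pos].
    - right. unfold K. field. lra. }
  replace ((PI - 4 * gauss (kappa * L)) / d) with (PI / d - 4 * gauss (kappa * L) / d) in Hb
    by (field; lra).
  apply Rabs_def1; lra.
Qed.

End GaussBox.

(** * Convergence of the lattice sums *)

Definition sqrt_succ (n : nat) : R := sqrt (INR n + 1).

Lemma sqrt_succ_sq (n : nat) : sqrt_succ n ^ 2 = INR n + 1.
Proof. apply pow2_sqrt. pose proof (pos_INR n). lra. Qed.

Lemma sqrt_succ_ge_1 (n : nat) : 1 <= sqrt_succ n.
Proof.
  pose proof (sqrt_succ_sq n). pose proof (pos_INR n). pose proof (sqrt_pos (INR n + 1)).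
  change (0 <= sqrt_succ n) in H1. nra.
Qed.

Lemma sqrt_succ_unbounded (c : R) : exists n0, (1 <= n0)%nat /\ forall n, (n0 <= n)%nat -> c <= sqrt_succ n.
Proof.
  destruct (INR_unbounded (c ^ 2)) as [n0 Hn0].
  exists (S n0). split; [lia|]. intros n Hn.
  assert (INR n0 <= INR n) by (apply le_INR; lia).
  pose proof (sqrt_succ_sq n). pose proof (sqrt_succ_ge_1 n). nra.
Qed.

(** With N = 2n this equals sqrt(2/n) for n >= 1, and [scale n * dev n k] is the value of sqrt(N)
    times a block magnetization with [k] plus spins. *)
Definition scale (n : nat) : R := sqrt (INR (2 * n)) * (2 / INR (2 * n)).

Lemma scale_sq (n : nat) : (1 <= n)%nat -> scale n ^ 2 = 2 / INR n.
Proof.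
  intros Hn. apply le_INR in Hn. change (INR 1) with 1 in Hn.
  unfold scale. rewrite mult_INR. change (INR 2) with 2.
  rewrite Rpow_mult_distr, pow2_sqrt by lra. field. lra.
Qed.

Lemma scale_bounds (n : nat) : (1 <= n)%nat -> / sqrt_succ n <= scale n <= 2 / sqrt_succ n.
Proof.
  intros Hn. pose proof (scale_sq n Hn) as Hs. pose proof (sqrt_succ_sq n) as Hq.
  pose proof (sqrt_succ_ge_1 n) as Hq1.
  apply le_INR in Hn. change (INR 1) with 1 in Hn.
  assert (Hs0 : 0 <= scale n).
  { unfold scale. apply Rmult_le_pos; [apply sqrt_pos|]. rewrite mult_INR.
    change (INR 2) with 2. apply Rdiv_le_0_compat; lra. }
  assert (Hp : (scale n * sqrt_succ n) ^ 2 = 2 + 2 * / INR n).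
  { rewrite Rpow_mult_distr, Hs, Hq. field. lra. }
  assert (0 < / INR n <= 1).
  { split; [apply Rinv_0_lt_compat; lra|]. rewrite <- Rinv_1. apply Rinv_le_contravar; lra. }
  assert (Hsq : 0 <= scale n * sqrt_succ n) by nra.
  split; (apply Rmult_le_reg_r with (sqrt_succ n); [lra|]).
  - rewrite Rinv_l by lra. nra.
  - unfold Rdiv. rewrite Rmult_assoc, Rinv_l by lra. nra.
Qed.

Lemma scale_pos (n : nat) : (1 <= n)%nat -> 0 < scale n.
Proof.
  intros Hn. pose proof (scale_bounds n Hn) as [Hs _]. pose proof (sqrt_succ_ge_1 n).
  assert (0 < / sqrt_succ n) by (apply Rinv_0_lt_compat; lra). lra.
Qed.

Lemma bratio_cv (K eps : R) : 0 <= K -> 0 < eps ->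
  exists c, forall n k, (1 <= n)%nat -> (k <= n)%nat -> c <= sqrt_succ n ->
    Rabs (scale n * dev n k) <= K -> 1 - eps <= bratio n k.
Proof.
  intros HK Heps.
  (* As |d| + 1 <= (K+1) q with q = sqrt(n+1), the X of [bratio_ge] is at most (K+1)/q and the loss
     at most (K+1)^3/q; the two thresholds give X <= 1/2 and loss <= eps. *)
  exists (Rmax (2 * (K + 1)) ((K + 1) ^ 3 / eps)). intros n k Hn Hk Hc Hd.
  pose proof (Rle_trans _ _ _ (Rmax_l _ _) Hc) as Hc1.
  pose proof (Rle_trans _ _ _ (Rmax_r _ _) Hc) as Hc2.
  pose proof (sqrt_succ_ge_1 n) as Hq1. pose proof (scale_bounds n Hn) as [Hs _].
  pose proof (sqrt_succ_sq n) as Hq. set (q := sqrt_succ n) in *. set (s := scale n) in *.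
  assert (Hqi : 0 < / q) by (apply Rinv_0_lt_compat; lra).
  set (D := Rabs (dev n k) + 1).
  assert (HD : D <= (K + 1) * q).
  { rewrite Rabs_mult, (Rabs_pos_eq s) in Hd by lra.
    assert (Rabs (dev n k) <= K * q).
    { pose proof (Rabs_pos (dev n k)).
      apply Rmult_le_reg_l with (/ q); [exact Hqi|].
      replace (/ q * (K * q)) with K by (field; lra). nra. }
    unfold D. lra. }
  assert (HD1 : 1 <= D) by (unfold D; pose proof (Rabs_pos (dev n k)); lra).
  assert (HX : D / (INR n + 1) <= (K + 1) / q).
  { rewrite <- Hq. apply Rle_trans with ((K + 1) * q / q ^ 2).
    - apply Rmult_le_compat_r; [left; apply Rinv_0_lt_compat; nra | exact HD].
    - right. field. lra. }
  assert (HX0 : 0 <= D / (INR n + 1)) by (rewrite <- Hq; apply Rdiv_le_0_compat; nra).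
  eapply Rle_trans; [|apply bratio_ge; [exact Hk|]]; fold D.
  - assert (D * (D / (INR n + 1)) ^ 2 <= (K + 1) * q * ((K + 1) / q) ^ 2).
    { apply Rmult_le_compat; [lra | apply pow2_ge_0 | exact HD | apply pow_incr; lra]. }
    replace ((K + 1) * q * ((K + 1) / q) ^ 2) with ((K + 1) ^ 3 / q) in H by (field; lra).
    assert ((K + 1) ^ 3 / q <= eps).
    { apply Rmult_le_reg_r with (q / eps); [apply Rdiv_lt_0_compat; lra|].
      replace ((K + 1) ^ 3 / q * (q / eps)) with ((K + 1) ^ 3 / eps) by (field; lra).
      replace (eps * (q / eps)) with q by (field; lra). exact Hc2. }
    lra.
  - eapply Rle_trans; [exact HX|].
    apply Rmult_le_reg_r with q; [lra|]. unfold Rdiv at 1.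
    rewrite Rmult_assoc, Rinv_l by lra. lra.
Qed.

(** The square leaves a factor to spare: far out one factor makes the error small, the other remains
    as the integrable envelope. *)
Lemma gauss_le_cauchy (k : R) : 0 < k ->
  exists C1, 0 < C1 /\ forall x, exp (- (k * x ^ 2)) <= C1 * cauchy x ^ 2.
Proof.
  intros Hk. set (m := Rmin 1 (k / 2)).
  assert (Hm : 0 < m) by (apply Rmin_pos; lra).
  assert (Hm1 : m <= 1) by apply Rmin_l. assert (Hm2 : m <= k / 2) by apply Rmin_r.
  exists (/ m ^ 2). split; [apply Rinv_0_lt_compat; nra|]. intros x.
  unfold cauchy. rewrite <- pow_inv, <- Rpow_mult_distr, <- Rinv_mult, pow_inv.
  rewrite exp_Ropp. apply Rinv_le_contravar.
  - apply pow_lt, Rmult_lt_0_compat; [exact Hm | nra].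
  - replace (k * x ^ 2) with (k / 2 * x ^ 2 + k / 2 * x ^ 2) by field.
    rewrite exp_plus. pose proof (exp_ineq1_le (k / 2 * x ^ 2)) as H.
    assert (Hle : m * (1 + x ^ 2) <= exp (k / 2 * x ^ 2)) by nra.
    assert (0 <= m * (1 + x ^ 2)) by nra. nra.
Qed.

(** From x^2 <= 2s^2 + 2(x-s)^2 <= 2s^2 + 2, the first inequality being (x - 2s)^2 >= 0. *)
Lemma cauchy_shift (x s : R) : Rabs (x - s) <= 1 -> cauchy s <= 3 * cauchy x.
Proof.
  intros H. apply Rabs_le_between in H. unfold cauchy.
  assert (H1 : 1 + x ^ 2 <= 3 * (1 + s ^ 2)).
  { pose proof (pow2_ge_0 (x - 2 * s)). nra. }
  apply Rmult_le_reg_l with ((1 + s ^ 2) * (1 + x ^ 2)); [apply Rmult_lt_0_compat; nra|].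
  replace ((1 + s ^ 2) * (1 + x ^ 2) * / (1 + s ^ 2)) with (1 + x ^ 2) by (field; nra).
  replace ((1 + s ^ 2) * (1 + x ^ 2) * (3 * / (1 + x ^ 2))) with (3 * (1 + s ^ 2)) by (field; nra).
  exact H1.
Qed.

Lemma cauchy_le_1 (x : R) : cauchy x <= 1.
Proof. unfold cauchy. rewrite <- Rinv_1. apply Rinv_le_contravar; nra. Qed.

Lemma cauchy_far (x K : R) : 0 <= K <= Rabs x -> cauchy x <= cauchy K.
Proof.
  intros H. unfold cauchy. apply Rinv_le_contravar; [nra|].
  rewrite <- (pow2_abs x). nra.
Qed.

Lemma cauchy_near (x K : R) : Rabs x <= K -> cauchy K <= cauchy x.
Proof.
  intros H. pose proof (Rabs_pos x). unfold cauchy. apply Rinv_le_contravar; [nra|].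
  rewrite <- (pow2_abs x). nra.
Qed.

(** * Domination and local convergence of the lattice weights *)

Section Weight.

Variables a b : R.
Hypothesis Hab : 0 <= b < a.

(* The correction [(x^2 + y^2) / (4 (n + 1))] compensates for the tilt in [bratio], which uses
   [n + 1] where the Gaussian limit has [n]. *)
Definition weight (n k l : nat) : R :=
  bratio n k * bratio n l *
  exp (- quad a b (scale n * dev n k) (scale n * dev n l)
       + ((scale n * dev n k) ^ 2 + (scale n * dev n l) ^ 2) / (4 * (INR n + 1))).

(** The difference of the two sides is b (x-y)^2; a - b is the smallest eigenvalue of the form. *)
Lemma quad_ge (x y : R) : (a - b) * (x ^ 2 + y ^ 2) <= quad a b x y.
Proof. unfold quad. pose proof (pow2_ge_0 (x - y)). nra. Qed.

Lemma weight_dominated : exists c C1, 0 < C1 /\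
  (forall x y, exp (- quad a b x y) <= C1 * (cauchy x * cauchy y) ^ 2) /\
  (forall n k l, (k <= n)%nat -> (l <= n)%nat -> c <= sqrt_succ n ->
    0 <= weight n k l <= C1 * (cauchy (scale n * dev n k) * cauchy (scale n * dev n l)) ^ 2).
Proof.
  (* Half of the decay rate a - b is kept; the other half absorbs the correction in [weight] as soon
     as 1/(4(n+1)) <= k0. *)
  set (k0 := (a - b) / 2).
  destruct (gauss_le_cauchy k0) as [C1 [HC1 HG]]; [unfold k0; lra|].
  assert (HGG : forall x y z, z <= - (k0 * (x ^ 2 + y ^ 2)) ->
                  exp z <= C1 ^ 2 * (cauchy x * cauchy y) ^ 2).
  { intros x y z Hz. eapply Rle_trans; [apply exp_nondecr, Hz|].
    replace (- (k0 * (x ^ 2 + y ^ 2))) with (- (k0 * x ^ 2) + - (k0 * y ^ 2)) by ring.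
    rewrite exp_plus, Rpow_mult_distr.
    replace (C1 ^ 2 * (cauchy x ^ 2 * cauchy y ^ 2))
      with ((C1 * cauchy x ^ 2) * (C1 * cauchy y ^ 2)) by ring.
    apply Rmult_le_compat; try (left; apply exp_pos); apply HG. }
  exists (/ k0 + 1), (C1 ^ 2). split; [nra|]. split.
  - intros x y. apply HGG. pose proof (quad_ge x y).
    unfold k0. pose proof (pow2_ge_0 x). pose proof (pow2_ge_0 y). nra.
  - intros n k l Hk Hl Hc. unfold weight.
    set (x := scale n * dev n k). set (y := scale n * dev n l).
    pose proof (bratio_pos n k). pose proof (bratio_pos n l).
    pose proof (bratio_le_1 n k Hk). pose proof (bratio_le_1 n l Hl).
    set (e := exp _).
    assert (He : 0 < e) by apply exp_pos.
    assert (Heb : e <= C1 ^ 2 * (cauchy x * cauchy y) ^ 2).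
    { apply HGG. rewrite <- sqrt_succ_sq. pose proof (quad_ge x y).
      assert (Hk0 : 0 < k0) by (unfold k0; lra).
      assert (0 < / k0) by (apply Rinv_0_lt_compat, Hk0).
      assert (Hi : / (4 * sqrt_succ n ^ 2) <= k0).
      { rewrite <- (Rinv_inv k0). apply Rinv_le_contravar; [assumption|]. nra. }
      pose proof (pow2_ge_0 x). pose proof (pow2_ge_0 y).
      apply (Rmult_le_compat_l (x ^ 2 + y ^ 2)) in Hi; [|lra].
      unfold Rdiv, k0 in *. lra. }
    assert (HB : 0 < bratio n k * bratio n l <= 1) by nra.
    split; [nra|]. nra.
Qed.

Lemma weight_close (K eps : R) : 0 <= K -> 0 < eps ->
  exists c, forall n k l, (1 <= n)%nat -> (k <= n)%nat -> (l <= n)%nat -> c <= sqrt_succ n ->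
    Rabs (scale n * dev n k) <= K -> Rabs (scale n * dev n l) <= K ->
    Rabs (weight n k l - exp (- quad a b (scale n * dev n k) (scale n * dev n l))) <= eps.
Proof.
  (* With e2 <= 1/2, a correction eta <= e2 satisfies exp(eta) <= 1/(1-e2) <= 1 + 2 e2, and the
     product of the two ratios is at least 1 - 2 e2; the total relative error 2 e2 is at most
     eps. *)
  intros HK Heps. set (e2 := Rmin (1 / 2) (eps / 2)).
  assert (He2 : 0 < e2) by (apply Rmin_pos; lra).
  assert (He21 : e2 <= 1 / 2) by apply Rmin_l.
  assert (He22 : e2 <= eps / 2) by apply Rmin_r.
  destruct (bratio_cv K e2 HK He2) as [c1 Hc1].
  exists (Rmax c1 (K ^ 2 / e2)). intros n k l Hn Hk Hl Hc Hx Hy.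
  pose proof (Rle_trans _ _ _ (Rmax_l _ _) Hc) as Hq1.
  pose proof (Rle_trans _ _ _ (Rmax_r _ _) Hc) as Hq2.
  pose proof (Hc1 n k Hn Hk Hq1 Hx) as Hbk. pose proof (Hc1 n l Hn Hl Hq1 Hy) as Hbl.
  pose proof (bratio_le_1 n k Hk). pose proof (bratio_le_1 n l Hl).
  unfold weight. set (x := scale n * dev n k) in *. set (y := scale n * dev n l) in *.
  set (eta := (x ^ 2 + y ^ 2) / (4 * (INR n + 1))).
  assert (Heta0 : 0 <= eta).
  { pose proof (pos_INR n). apply Rdiv_le_0_compat; [|lra].
    pose proof (pow2_ge_0 x). pose proof (pow2_ge_0 y). lra. }
  assert (Heta : eta <= e2).
  { unfold eta. rewrite <- sqrt_succ_sq. pose proof (sqrt_succ_ge_1 n).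
    apply Rmult_le_reg_r with (4 * sqrt_succ n ^ 2); [nra|].
    unfold Rdiv. rewrite Rmult_assoc, Rinv_l by nra.
    apply (Rmult_le_compat_l e2) in Hq2; [|lra].
    replace (e2 * (K ^ 2 / e2)) with (K ^ 2) in Hq2 by (field; lra).
    rewrite <- (pow2_abs x), <- (pow2_abs y).
    pose proof (Rabs_pos x). pose proof (Rabs_pos y).
    assert (Rabs x ^ 2 <= K ^ 2) by (apply pow_incr; lra).
    assert (Rabs y ^ 2 <= K ^ 2) by (apply pow_incr; lra).
    assert (e2 * sqrt_succ n <= e2 * sqrt_succ n ^ 2) by nra. nra. }
  rewrite exp_plus.
  assert (He1 : 1 <= exp eta <= 1 + 2 * e2).
  { split; [pose proof (exp_ineq1_le eta); lra|].
    pose proof (exp_ineq1_le (- eta)) as H1. rewrite exp_Ropp in H1.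
    pose proof (exp_pos eta).
    apply (Rmult_le_compat_l (exp eta)) in H1; [|lra]. rewrite Rinv_r in H1 by lra.
    nra. }
  assert (HW : 0 < exp (- quad a b x y) <= 1).
  { split; [apply exp_pos|]. rewrite <- exp_0. apply exp_nondecr.
    pose proof (quad_ge x y). pose proof (pow2_ge_0 x). pose proof (pow2_ge_0 y). nra. }
  set (W := exp (- quad a b x y)) in *.
  replace (bratio n k * bratio n l * (W * exp eta) - W)
    with (W * (bratio n k * bratio n l * exp eta - 1)) by ring.
  rewrite Rabs_mult, (Rabs_pos_eq W) by lra.
  assert (HBB : 1 - 2 * e2 <= bratio n k * bratio n l <= 1) by nra.
  assert (Rabs (bratio n k * bratio n l * exp eta - 1) <= 2 * e2).
  { apply Rabs_le. nra. }
  pose proof (Rabs_pos (bratio n k * bratio n l * exp eta - 1)). nra.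
Qed.

(** Let P be the envelope at (x, y). Outside a large square both terms are O(P^2), hence at most eps
    P since P is small there; inside it, [weight_close] and the uniform continuity of the limit
    integrand suffice. *)
Lemma weighted_close (f : R -> R -> R) (eps : R) : bounded2 f -> continuous2 f -> 0 < eps ->
  exists n0, (1 <= n0)%nat /\ forall n k l x y, (n0 <= n)%nat -> (k <= n)%nat -> (l <= n)%nat ->
    Rabs (x - scale n * dev n k) <= scale n -> Rabs (y - scale n * dev n l) <= scale n ->
    Rabs (f (scale n * dev n k) (scale n * dev n l) * weight n k l
          - f x y * exp (- quad a b x y)) <= eps * (cauchy x * cauchy y).
Proof.
  intros [M0 HM0] Hf Heps.
  assert (HM : exists M, 0 < M /\ forall x y, Rabs (f x y) <= M).
  { exists (M0 + 1). split; [pose proof (HM0 0 0); pose proof (Rabs_pos (f 0 0)); lra|].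
    intros x y. pose proof (HM0 x y). lra. }
  clear M0 HM0. destruct HM as [M [HM HfM]].
  destruct weight_dominated as [c1 [C1 [HC1 [HdomW Hdom]]]].
  (* 82 = 81 + 1: [cauchy_shift] loses a factor 3 in each coordinate, and the dominating bound is
     squared, giving (9 P)^2 for the lattice term; the limit term adds P^2. *)
  set (Ct := 82 * M * C1). assert (HCt : 0 < Ct) by (unfold Ct; nra).
  set (K := Ct / eps + 1).
  assert (HK1 : 1 <= K) by (unfold K; pose proof (Rdiv_lt_0_compat _ _ HCt Heps); lra).
  assert (HKfar : Ct * cauchy K <= eps).
  { unfold cauchy. apply Rmult_le_reg_r with ((1 + K ^ 2) / eps).
    { apply Rdiv_lt_0_compat; [nra | exact Heps]. }
    replace (Ct * / (1 + K ^ 2) * ((1 + K ^ 2) / eps)) with (Ct / eps)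
      by (field; split; nra).
    replace (Ct / eps) with (K - 1) by (unfold K; ring).
    replace (eps * ((1 + K ^ 2) / eps)) with (1 + K ^ 2) by (field; lra). nra. }
  (* On |x|, |y| <= K the envelope is at least [cauchy K ^ 2], so a uniform error [e'] is enough
     there. *)
  set (e' := eps * cauchy K ^ 2).
  assert (He' : 0 < e') by (apply Rmult_lt_0_compat; [exact Heps | apply pow_lt, cauchy_pos]).
  assert (Hg : continuous2 (fun x y => f x y * exp (- quad a b x y)))
    by (apply continuous2_mult; [exact Hf | apply continuous2_exp_quad]).
  assert (He'2 : 0 < e' / 2) by lra.
  destruct (uniform_continuity_2d _ (- (K + 1)) (K + 1) (- (K + 1)) (K + 1)
    (fun u v _ _ => continuous2_2d_pt _ Hg u v) (mkposreal _ He'2)) as [d Hd].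
  simpl in Hd. pose proof (cond_pos d) as Hd0.
  destruct (weight_close (K + 1) (e' / (2 * M))) as [c2 Hc2].
  { lra. } { apply Rdiv_lt_0_compat; lra. }
  (* Since scale <= 2/sqrt(n+1), the thresholds 2 and 4/d make the cell half width at most 1 (for
     [cauchy_shift]) and less than [d]. *)
  destruct (sqrt_succ_unbounded (Rmax (Rmax c1 c2) (Rmax 2 (4 / d)))) as [n0 [Hn0 Hrt]].
  exists n0; split; [exact Hn0|].
  intros n k l x y Hn Hk Hl Hx Hy. specialize (Hrt n Hn).
  assert (Hn1 : (1 <= n)%nat) by lia.
  assert (Hr1 : c1 <= sqrt_succ n)
    by (eapply Rle_trans; [|exact Hrt]; eapply Rle_trans; [apply Rmax_l|apply Rmax_l]).
  assert (Hr2 : c2 <= sqrt_succ n)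
    by (eapply Rle_trans; [|exact Hrt]; eapply Rle_trans; [apply Rmax_r|apply Rmax_l]).
  assert (Hr3 : 2 <= sqrt_succ n)
    by (eapply Rle_trans; [|exact Hrt]; eapply Rle_trans; [apply Rmax_l|apply Rmax_r]).
  assert (Hr4 : 4 / d <= sqrt_succ n)
    by (eapply Rle_trans; [|exact Hrt]; eapply Rle_trans; [apply Rmax_r|apply Rmax_r]).
  pose proof (scale_bounds n Hn1) as [_ Hs].
  assert (Hs1 : scale n <= 1).
  { eapply Rle_trans; [exact Hs|]. apply Rmult_le_reg_r with (sqrt_succ n); [lra|].
    unfold Rdiv. rewrite Rmult_assoc, Rinv_l; lra. }
  assert (Hsd : scale n < d).
  { eapply Rle_lt_trans; [exact Hs|]. apply Rmult_lt_reg_r with (sqrt_succ n); [lra|].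
    unfold Rdiv. rewrite Rmult_assoc, Rinv_l by lra.
    apply (Rmult_le_compat_l d) in Hr4; [|lra].
    replace (d * (4 / d)) with 4 in Hr4 by (field; lra). lra. }
  specialize (Hdom n k l Hk Hl Hr1). specialize (HdomW x y).
  specialize (Hc2 n k l Hn1 Hk Hl Hr2).
  set (xk := scale n * dev n k) in *. set (yl := scale n * dev n l) in *.
  pose proof (cauchy_pos x) as Hpx. pose proof (cauchy_pos y) as Hpy.
  pose proof (cauchy_le_1 x) as Hpx1. pose proof (cauchy_le_1 y) as Hpy1.
  set (P := cauchy x * cauchy y) in *.
  assert (HP : 0 < P) by (apply Rmult_lt_0_compat; assumption).
  assert (Hfar : P <= cauchy K -> Rabs (f xk yl * weight n k l - f x y * exp (- quad a b x y))
            <= eps * P).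
  { intros HPK.
    assert (HPs : cauchy xk * cauchy yl <= 9 * P).
    { pose proof (cauchy_shift x xk (Rle_trans _ _ _ Hx Hs1)).
      pose proof (cauchy_shift y yl (Rle_trans _ _ _ Hy Hs1)).
      pose proof (cauchy_pos xk). pose proof (cauchy_pos yl).
      replace (9 * P) with ((3 * cauchy x) * (3 * cauchy y)) by (unfold P; ring).
      apply Rmult_le_compat; lra. }
    assert (H1 : Rabs (f xk yl * weight n k l) <= M * (C1 * (81 * P ^ 2))).
    { rewrite Rabs_mult, (Rabs_pos_eq (weight n k l)) by lra.
      apply Rmult_le_compat; [apply Rabs_pos | lra | apply HfM|].
      eapply Rle_trans; [apply Hdom|]. apply Rmult_le_compat_l; [lra|].
      replace (81 * P ^ 2) with ((9 * P) ^ 2) by ring. apply pow_incr.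
      split; [|exact HPs]. left. apply Rmult_lt_0_compat; apply cauchy_pos. }
    assert (H2 : Rabs (f x y * exp (- quad a b x y)) <= M * (C1 * P ^ 2)).
    { rewrite Rabs_mult, (Rabs_pos_eq (exp _)) by (left; apply exp_pos).
      apply Rmult_le_compat; [apply Rabs_pos | left; apply exp_pos | apply HfM | exact HdomW]. }
    eapply Rle_trans; [apply Rabs_triang|]. rewrite Rabs_Ropp.
    apply Rle_trans with (Ct * P * P); [unfold Ct; lra|].
    apply Rmult_le_compat_r; [lra|].
    eapply Rle_trans; [|exact HKfar]. apply Rmult_le_compat_l; lra. }
  destruct (Rle_or_lt (Rabs x) K) as [HxK|HxK].
  2:{ apply Hfar. pose proof (cauchy_far x K). unfold P. nra. }
  destruct (Rle_or_lt (Rabs y) K) as [HyK|HyK].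
  2:{ apply Hfar. pose proof (cauchy_far y K). unfold P. nra. }
  assert (Hxk : Rabs xk <= K + 1).
  { replace xk with (x + - (x - xk)) by ring. eapply Rle_trans; [apply Rabs_triang|].
    rewrite Rabs_Ropp. lra. }
  assert (Hyl : Rabs yl <= K + 1).
  { replace yl with (y + - (y - yl)) by ring. eapply Rle_trans; [apply Rabs_triang|].
    rewrite Rabs_Ropp. lra. }
  specialize (Hc2 Hxk Hyl).
  replace (f xk yl * weight n k l - f x y * exp (- quad a b x y)) with
    (f xk yl * (weight n k l - exp (- quad a b xk yl)) +
     (f xk yl * exp (- quad a b xk yl) - f x y * exp (- quad a b x y))) by ring.
  apply Rle_trans with e'.
  - eapply Rle_trans; [apply Rabs_triang|]. rewrite Rabs_mult.
    assert (Rabs (f xk yl) * Rabs (weight n k l - exp (- quad a b xk yl)) <= M * (e' / (2 * M)))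
      by (apply Rmult_le_compat; [apply Rabs_pos | apply Rabs_pos | apply HfM | exact Hc2]).
    replace (M * (e' / (2 * M))) with (e' / 2) in H by (field; lra).
    assert (Rabs (f xk yl * exp (- quad a b xk yl) - f x y * exp (- quad a b x y)) < e' / 2).
    { apply Rabs_le_between in HxK, HyK, Hxk, Hyl.
      apply (Hd x y xk yl); try lra.
      - rewrite Rabs_minus_sym. lra.
      - rewrite Rabs_minus_sym. lra. }
    lra.
  - unfold e'. apply Rmult_le_compat_l; [lra|].
    pose proof (cauchy_near x K HxK). pose proof (cauchy_near y K HyK).
    pose proof (cauchy_pos K). unfold P. simpl. rewrite Rmult_1_r.
    apply Rmult_le_compat; lra.
Qed.

(** The mesh is [2 * scale n] because [dev n k] advances in steps of 2. *)
Definition lattice_sum (f : R -> R -> R) (n : nat) : R :=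
  2 * scale n * sum_f_R0 (fun k => 2 * scale n * sum_f_R0 (fun l =>
    f (scale n * dev n k) (scale n * dev n l) * weight n k l) n) n.

Lemma lattice_sum_cv (f : R -> R -> R) (v : R) : bounded2 f -> continuous2 f ->
  (forall eps, 0 < eps -> exists L0, forall L, L0 <= L ->
     Rabs (box (fun x y => f x y * exp (- quad a b x y)) L - v) < eps) ->
  Un_cv (lattice_sum f) v.
Proof.
  intros Hb Hf Hv eps Heps.
  pose proof PI_RGT_0 as Hpi.
  set (e := eps / 2 / PI ^ 2).
  assert (He : 0 < e) by (apply Rdiv_lt_0_compat; nra).
  destruct (weighted_close f e Hb Hf He) as [n1 [Hn1 Hclose]].
  destruct (Hv (eps / 2)) as [L0 HL0]; [lra|].
  destruct (sqrt_succ_unbounded L0) as [n2 [_ Hrt]].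
  exists (max n1 n2). intros n Hn. unfold R_dist.
  assert (Hn' : (1 <= n)%nat) by lia.
  pose proof (scale_bounds n Hn') as [Hs _].
  pose proof (sqrt_succ_ge_1 n) as Hq1.
  assert (Hqi : 0 < / sqrt_succ n) by (apply Rinv_0_lt_compat; lra).
  (* The n + 1 cells per axis fill [-L, L] with L = (n+1) [scale n] >= sqrt(n+1), so the square
     compared with eventually exceeds any [L0]. *)
  assert (HL : L0 <= INR (S n) * (2 * scale n) / 2).
  { eapply Rle_trans; [apply (Hrt n); lia|]. rewrite S_INR, <- sqrt_succ_sq.
    replace (sqrt_succ n ^ 2 * (2 * scale n) / 2) with (sqrt_succ n ^ 2 * scale n) by field.
    apply Rle_trans with (sqrt_succ n ^ 2 * / sqrt_succ n); [right; field; lra|].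
    apply Rmult_le_compat_l; [apply pow2_ge_0 | exact Hs]. }
  specialize (HL0 _ HL).
  assert (Hgrid := grid_sum
    (fun k l => f (scale n * dev n k) (scale n * dev n l) * weight n k l)
    (fun x y => f x y * exp (- quad a b x y)) (2 * scale n) e n).
  cbv zeta in Hgrid. fold (lattice_sum f n) in Hgrid.
  assert (Hbound : Rabs (lattice_sum f n - box (fun x y => f x y * exp (- quad a b x y))
                     (INR (S n) * (2 * scale n) / 2)) <= e * PI ^ 2).
  { apply Hgrid; [lra | lra | |].
    - apply continuous2_mult; [exact Hf | apply continuous2_exp_quad].
    - intros k l x y Hk Hl Hx Hy. apply Hclose; try assumption; [lia | |].
      + unfold dev. rewrite !S_INR in Hx. apply Rabs_le. lra.
      + unfold dev. rewrite !S_INR in Hy. apply Rabs_le. lra. }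
  replace (e * PI ^ 2) with (eps / 2) in Hbound by (unfold e; field; lra).
  match goal with |- Rabs ?z < _ => replace z with
    ((lattice_sum f n - box (fun x y => f x y * exp (- quad a b x y))
                     (INR (S n) * (2 * scale n) / 2)) +
     (box (fun x y => f x y * exp (- quad a b x y)) (INR (S n) * (2 * scale n) / 2) - v)) by ring end.
  eapply Rle_lt_trans; [apply Rabs_triang | lra].
Qed.

End Weight.

(** * Identification of the limit *)

(** With x = s u and s^2 = 2/n, the energy gives beta x^2/8 and undoing the tilt gives -u^2/(2(n+1))
    = -x^2/4 + x^2/(4(n+1)); the last term is the correction in [weight]. *)
Lemma gibbs_weight (alpha beta : R) (n k l : nat) : (1 <= n)%nat ->
  C n k * C n l * exp (energy alpha beta (INR (2 * n)) (dev n k) (dev n l)) =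
  tilted n (n / 2) ^ 2 * weight ((2 - beta) / 8) (alpha / 8) n k l.
Proof.
  intros Hn. pose proof (scale_sq n Hn) as Hs.
  apply le_INR in Hn. change (INR 1) with 1 in Hn.
  unfold weight, bratio. pose proof (tilted_pos n (n / 2)) as Ht.
  set (u := dev n k). set (v := dev n l). set (s := scale n) in *.
  replace (- quad ((2 - beta) / 8) (alpha / 8) (s * u) (s * v)
           + ((s * u) ^ 2 + (s * v) ^ 2) / (4 * (INR n + 1)))
    with (energy alpha beta (INR (2 * n)) u v
          - u ^ 2 / (2 * (INR n + 1)) - v ^ 2 / (2 * (INR n + 1))).
  - unfold Rminus. rewrite !exp_plus, !exp_Ropp. unfold tilted at 2 4.
    fold u v. pose proof (exp_pos (u ^ 2 / (2 * (INR n + 1)))).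
    pose proof (exp_pos (v ^ 2 / (2 * (INR n + 1)))).
    field. repeat split; lra.
  - unfold quad, energy. rewrite mult_INR. change (INR 2) with 2.
    replace (s * u * (s * u)) with (s ^ 2 * u ^ 2) by ring.
    replace (s * v * (s * v)) with (s ^ 2 * v ^ 2) by ring.
    replace (s * u * (s * v)) with (s ^ 2 * (u * v)) by ring.
    rewrite !Rpow_mult_distr, Hs. field. lra.
Qed.

Lemma bsum2_lattice_sum (alpha beta : R) (f : R -> R -> R) (n : nat) : (1 <= n)%nat ->
  bsum n (fun u => bsum n (fun v => exp (energy alpha beta (INR (2 * n)) u v) *
      f (sqrt (INR (2 * n)) * (2 / INR (2 * n) * u))
        (sqrt (INR (2 * n)) * (2 / INR (2 * n) * v)))) =
  (tilted n (n / 2) / (2 * scale n)) ^ 2 *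
    lattice_sum ((2 - beta) / 8) (alpha / 8) f n.
Proof.
  intros Hn.
  pose proof (scale_pos n Hn) as Hs.
  unfold lattice_sum, bsum.
  rewrite <- (Rmult_assoc _ (2 * scale n)), scal_sum. apply sum_eq. intros k _.
  rewrite !scal_sum, (Rmult_comm (sum_f_R0 _ _)), scal_sum. apply sum_eq. intros l _.
  fold (dev n k) (dev n l). rewrite <- !(Rmult_assoc (sqrt _)). fold (scale n).
  pose proof (gibbs_weight alpha beta n k l Hn) as Hw.
  match goal with |- ?lhs = _ => replace lhs with
    (f (scale n * dev n k) (scale n * dev n l) *
     (C n k * C n l * exp (energy alpha beta (INR (2 * n)) (dev n k) (dev n l)))) by ring end.
  rewrite Hw. field. lra.
Qed.

Lemma gibbs_expect_lattice_sum (alpha beta : R) (Sb : nat -> bool) (f : R -> R -> R) (n : nat) :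
  (1 <= n)%nat -> length (filter Sb (seq 0 (2 * n))) = n ->
  gibbs_expect (2 * n) alpha beta Sb
    (fun sg => f (sqrt (INR (2 * n)) * mag1 (2 * n) Sb sg)
                 (sqrt (INR (2 * n)) * mag2 (2 * n) Sb sg)) =
  lattice_sum ((2 - beta) / 8) (alpha / 8) f n
  / lattice_sum ((2 - beta) / 8) (alpha / 8) (fun _ _ => 1) n.
Proof.
  intros Hn HS. rewrite gibbs_expect_bsum by exact HS.
  rewrite bsum2_lattice_sum by exact Hn.
  rewrite (bsum_ext n _ (fun u => bsum n (fun v =>
    exp (energy alpha beta (INR (2 * n)) u v) * (fun _ _ => 1)
      (sqrt (INR (2 * n)) * (2 / INR (2 * n) * u))
      (sqrt (INR (2 * n)) * (2 / INR (2 * n) * v)))))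
    by (intros; apply bsum_ext; intros; ring).
  rewrite (bsum2_lattice_sum alpha beta (fun _ _ => 1)) by exact Hn.
  pose proof (tilted_pos n (n / 2)).
  pose proof (scale_pos n Hn) as Hs.
  assert (0 < tilted n (n / 2) / (2 * scale n)) by (apply Rdiv_lt_0_compat; lra).
  set (w := (tilted n (n / 2) / (2 * scale n)) ^ 2).
  assert (Hw : w <> 0) by (apply pow_nonzero; lra).
  generalize (lattice_sum ((2 - beta) / 8) (alpha / 8) (fun _ _ => 1) n). intros d.
  unfold Rdiv at 1. rewrite Rinv_mult, (Rmult_comm w), <- Rmult_assoc, (Rmult_assoc _ w).
  rewrite Rinv_r by exact Hw. unfold Rdiv. ring.
Qed.

(** With p = (2-beta)^2 - alpha^2 the covariance has determinant 16/p, and half its inverse has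
    entries (2-beta)/8 and -alpha/8. The normalization 2 pi sqrt(16/p) equals 8 pi/sqrt(p). *)
Lemma gauss2_density_quad (alpha beta x y : R) : 0 <= alpha < 2 - beta ->
  let s2 := (8 - 4 * beta) / ((2 - beta) ^ 2 - alpha ^ 2) in
  let r := alpha / (2 - beta) in
  gauss2_density s2 (s2 * r) s2 x y =
  exp (- quad ((2 - beta) / 8) (alpha / 8) x y)
  / (PI / sqrt (((2 - beta) / 8) ^ 2 - (alpha / 8) ^ 2)).
Proof.
  intros Hab s2 r. set (p := (2 - beta) ^ 2 - alpha ^ 2).
  assert (Hp : 0 < p) by (unfold p; nra).
  assert (HD : s2 * s2 - (s2 * r) ^ 2 = 16 / p).
  { unfold s2, r. fold p. apply Rmult_eq_reg_r with (p ^ 2); [| nra].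
    transitivity ((8 - 4 * beta) ^ 2 - (8 - 4 * beta) ^ 2 * alpha ^ 2 / (2 - beta) ^ 2).
    - field. split; lra.
    - unfold p. field. unfold p in Hp; split; lra. }
  unfold gauss2_density. rewrite HD.
  assert (Hq : ((2 - beta) / 8) ^ 2 - (alpha / 8) ^ 2 = p / 64) by (unfold p; field).
  rewrite Hq.
  assert (H4 : sqrt (16 / p) = 4 / sqrt p).
  { rewrite sqrt_div by lra. replace 16 with (4 * 4) by ring. rewrite sqrt_square by lra. reflexivity. }
  assert (H8 : sqrt (p / 64) = sqrt p / 8).
  { rewrite sqrt_div by lra. replace 64 with (8 * 8) by ring. rewrite sqrt_square by lra. reflexivity. }
  rewrite H4, H8. pose proof (sqrt_lt_R0 p Hp). pose proof PI_RGT_0.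
  f_equal.
  - f_equal. unfold s2, r. fold p. unfold quad. field. split; lra.
  - field. lra.
Qed.

Lemma box_scal (g : R -> R -> R) (c L : R) : 0 <= L -> continuous2 g ->
  box (fun x y => c * g x y) L = c * box g L.
Proof.
  intros HL Hg. unfold box.
  rewrite <- RInt_scal_R by (apply ex_RInt_cont; intros; apply box_inner_cont; assumption).
  apply RInt_ext_R. intros x _. apply RInt_scal_R, ex_RInt_cont.
  intros; apply continuous2_snd, Hg.
Qed.

Lemma continuous2_const (c : R) : continuous2 (fun _ _ => c).
Proof. apply continuous2_of_2d_pt. intros. apply continuity_2d_pt_const. Qed.

Theorem theorem1p2 (alpha beta : R) (S : nat -> nat -> bool) :
  0 <= alpha -> alpha < beta -> alpha + beta < 2 ->
  (forall n : nat, length (filter (S n) (seq 0 (2 * n))) = n) ->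
  let s2 := (8 - 4 * beta) / ((2 - beta) ^ 2 - alpha ^ 2) in
  let r := alpha / (2 - beta) in
  conv_in_distr_gauss2
    (fun n f =>
       gibbs_expect (2 * n) alpha beta (S n)
         (fun sg => f (sqrt (INR (2 * n)) * mag1 (2 * n) (S n) sg)
                      (sqrt (INR (2 * n)) * mag2 (2 * n) (S n) sg)))
    s2 (s2 * r) s2.
Proof.
  intros Ha Hab Hsum HS s2 r f Hfb Hf.
  set (a := (2 - beta) / 8). set (b := alpha / 8).
  assert (Hba : 0 <= b < a) by (unfold a, b; lra).
  set (Z := PI / sqrt (a ^ 2 - b ^ 2)).
  assert (HZ : 0 < Z).
  { apply Rdiv_lt_0_compat; [apply PI_RGT_0 | apply sqrt_lt_R0; nra]. }
  set (g := fun x y => f x y * exp (- quad a b x y)).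
  assert (Hg : continuous2 g) by (apply continuous2_mult; [exact Hf | apply continuous2_exp_quad]).
  destruct Hfb as [M HM].
  assert (HM0 : 0 <= M) by (eapply Rle_trans; [apply Rabs_pos | apply (HM 0 0)]).
  destruct (weight_dominated a b Hba) as [_ [C1 [HC1 [HdomW _]]]].
  destruct (box_cv g (M * C1) Hg) as [v Hv].
  { nra. }
  { intros x y. unfold g.
    rewrite Rabs_mult, (Rabs_pos_eq (exp _)) by (left; apply exp_pos).
    rewrite Rmult_assoc. apply Rmult_le_compat; [apply Rabs_pos | left; apply exp_pos | apply HM |].
    eapply Rle_trans; [apply HdomW|]. apply Rmult_le_compat_l; [lra|].
    pose proof (cauchy_pos x). pose proof (cauchy_pos y).
    pose proof (cauchy_le_1 x). pose proof (cauchy_le_1 y).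
    assert (0 < cauchy x * cauchy y <= 1) by nra. nra. }
  (* [Z] is the full integral of the unnormalized Gaussian and [v] that of [f] against it, so
     [v / Z] is the normalized expectation. *)
  exists (v / Z). split.
  - assert (Hdens : (fun x y => f x y * gauss2_density s2 (s2 * r) s2 x y) =
                    (fun x y => / Z * g x y)).
    { apply FunctionalExtensionality.functional_extensionality; intros x.
      apply FunctionalExtensionality.functional_extensionality; intros y.
      unfold s2, r. rewrite gauss2_density_quad by lra.
      unfold g. fold a b Z. unfold Rdiv. ring. }
    rewrite Hdens. apply integral_R2_of_box.
    { apply (continuous2_mult (fun _ _ => / Z)); [apply continuous2_const | exact Hg]. }
    intros eps Heps. destruct (Hv (eps * Z)) as [L0 HL0]; [nra|].
    exists (Rmax 0 L0). intros L HL.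
    pose proof (Rle_trans _ _ _ (Rmax_l _ _) HL).
    pose proof (Rle_trans _ _ _ (Rmax_r _ _) HL) as HL'.
    rewrite box_scal by assumption.
    replace (/ Z * box g L - v / Z) with (/ Z * (box g L - v)) by (field; lra).
    rewrite Rabs_mult, Rabs_pos_eq by (left; apply Rinv_0_lt_compat, HZ).
    apply Rmult_lt_reg_l with Z; [exact HZ|].
    rewrite <- Rmult_assoc, Rinv_r by lra. specialize (HL0 L HL'). lra.
  - assert (Hnum : Un_cv (lattice_sum a b f) v).
    { apply lattice_sum_cv; [exact Hba | exists M; exact HM | exact Hf | exact Hv]. }
    assert (Hden : Un_cv (lattice_sum a b (fun _ _ => 1)) Z).
    { apply lattice_sum_cv; [exact Hba | | apply continuous2_const |].
      - exists 1. intros _ _. rewrite Rabs_R1. lra.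
      - intros eps Heps. destruct (box_gauss_cv a b Hba eps Heps) as [L0 HL0].
        exists L0. intros L HL. specialize (HL0 L HL). fold Z in HL0.
        replace (fun x y => 1 * exp (- quad a b x y)) with (fun x y => exp (- quad a b x y));
          [exact HL0|].
        apply FunctionalExtensionality.functional_extensionality; intros x.
        apply FunctionalExtensionality.functional_extensionality; intros y. ring. }
    apply is_lim_seq_Reals.
    apply is_lim_seq_ext_loc with
      (fun n => lattice_sum a b f n / lattice_sum a b (fun _ _ => 1) n).
    (* The identity is available only from n = 1 on, because at n = 0 the scale divides by zero. *)
    + exists 1%nat. intros n Hn. symmetry.
      apply (gibbs_expect_lattice_sum alpha beta (S n) f n Hn (HS n)).
    + apply is_lim_seq_div'; [apply is_lim_seq_Reals, Hnum | apply is_lim_seq_Reals, Hden | lra].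
Qed.
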